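(* The red tiles (particles) of the uniform interlacing model with fixed top line $\beta^{(n)}$ form a determinantal point process with correlation kernel $$K_{\mathcal R}^{(n)}((x_1,y_1),(x_2,y_2))=-1_{x_1<x_2}\frac{1}{(2\pi i)^2}\oint_{\mathscr Z_n}dz\oint_{\mathscr W_n}dw\,\frac{\prod_{k=x_2+y_2-n}^{x_2-1}(z-k)}{\prod_{k=x_1+y_1-n}^{x_1}(w-k)}\frac1{w-z}\prod_{i=1}^n\frac{w-\beta_i^{(n)}}{z-\beta_i^{(n)}}$$ $$+1_{x_1\ge x_2}\frac{1}{(2\pi i)^2}\oint_{\mathscr Z_n'}dz\oint_{\mathscr W_n}dw\,\frac{\prod_{k=x_2+y_2-n}^{x_2-1}(z-k)}{\prod_{k=x_1+y_1-n}^{x_1}(w-k)}\frac1{w-z}\prod_{i=1}^n\frac{w-\beta_i^{(n)}}{z-\beta_i^{(n)}},$$ where all contours are counterclockwise oriented; $\mathscr Z_n$ contains $\{\beta_j^{(n)}:\beta_j^{(n)}\ge x_2\}$ but not the set $\{\beta_j^{(n)}:\beta_j^{(n)}\le x_2-1\}$; $\mathscr Z_n'$ contains $\{\beta_j^{(n)}:\beta_j^{(n)}<x_2\}$ but not the set $\{\beta_j^{(n)}:\beta_j^{(n)}\ge x_2\}$; and $\mathscr W_n$ contains the set $\{x_1+y_1-n,\dots,x_1\}$ and $\mathscr Z_n$, respectively $\mathscr Z_n'$. (A contour ''contains'' a set if it encloses every point of it; ''does not contain the set'' means it encloses no point of it.)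
   Context: **Interlacing model.** Fix $n$ and integers $\beta^{(n)}_1>\beta^{(n)}_2>\dots>\beta^{(n)}_n$. Consider the uniform probability measure on tuples $(y^{(1)},\dots,y^{(n)})\in\mathbb{Z}\times\mathbb{Z}^2\times\cdots\times\mathbb{Z}^n$ with $y^{(n)}=\beta^{(n)}$ and $$y_1^{(m+1)}\ge y_1^{(m)}>y_2^{(m+1)}\ge y_2^{(m)}>\dots\ge y_m^{(m)}>y_{m+1}^{(m+1)},\qquad 1\le m\le n-1.$$ There is a yellow particle (tile) at $(x,m)$ if $x$ is an entry of $y^{(m)}$. Such configurations are equivalent to lozenge tilings with three types of tiles (yellow, red, blue), and there is a red particle (tile) at $(x,m)$ exactly when $y^{(m)}_i<x<y^{(m-1)}_{i-1}$ for some $i\in\{1,\dots,m\}$, with the convention $y^{(m-1)}_0:=+\infty$. Positions considered are $(x,y)\in\mathbb{Z}\times\{1,\dots,n-1\}$ with $x\ge\beta_n^{(n)}+n-y$. A point process on a countable set is determinantal with correlation kernel $K$ if for all $k$ and all distinct points $p_1,\dots,p_k$, the probability that there are particles at all of $p_1,\dots,p_k$ equals $\det[K(p_i,p_j)]_{i,j=1}^k$. *)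

(* Defs.v *)
From mathcomp Require Export all_boot all_order all_algebra finmap complex.
From mathcomp Require Export all_classical all_reals all_analysis.

Set Implicit Arguments.
Unset Strict Implicit.
Unset Printing Implicit Defensive.

Import Order.TTheory GRing.Theory Num.Theory.
Import numFieldNormedType.Exports.

Local Open Scope classical_set_scope.
Local Open Scope ring_scope.
Local Open Scope complex_scope.

(* The increasing list of the integers k with a <= k <= b. *)
Definition zrange (a b : int) : seq int :=
  [seq a + i%:Z | i <- iota 0 (if a <= b then `|(b - a)%R|%N.+1 else 0%N)].

(* An array (y^(1), ..., y^(n)) in Z x Z^2 x ... x Z^n is the list of its rows;
   [shape y = iota 1 n] says that there are n rows, the m-th of length m.
   [entry y m i] is y^(m)_i, with the 1-based indices of the mathematics; it is
   only meaningful for 1 <= i <= m <= n. *)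
Definition entry (y : seq (seq int)) (m i : nat) : int :=
  nth 0 (nth [::] y m.-1) i.-1.

Definition interlacing (n : nat) (beta : n.-tuple int) :
    set (seq (seq int)) :=
  [set y | [/\ shape y = iota 1 n,
               nth [::] y n.-1 = beta
             & forall m i : nat, (1 <= m < n)%N -> (1 <= i <= m)%N ->
                 entry y m i <= entry y m.+1 i /\
                 entry y m.+1 i.+1 < entry y m i]].

(* The disjunct [i = 1] is the convention y^(m-1)_0 = +oo. *)
Definition red (y : seq (seq int)) : set (int * nat) :=
  [set p | exists i : nat,
     [/\ (1 <= i <= p.2)%N, entry y p.2 i < p.1
       & i = 1%N \/ p.1 < entry y p.2.-1 i.-1]].

Definition positions (n : nat) (beta : n.-tuple int) : set (int * nat) :=
  [set p | (1 <= p.2 <= n.-1)%N /\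
           nth 0 beta n.-1 + n%:Z - p.2%:Z <= p.1].

(* The probability of E under the uniform probability measure on a finite
   nonempty set A. *)
Definition uniform_prob (R : realType) (T : choiceType) (A E : set T) : R :=
  #|` fset_set (A `&` E) |%:R / #|` fset_set A |%:R.

(* X is a random set of particles on the space Omega with probability P; it is
   viewed as a point process on the countable set D. *)
Definition determinantal (R : realType) (Omega S : Type)
    (P : set Omega -> R) (X : Omega -> set S) (D : set S)
    (K : S -> S -> R[i]) : Prop :=
  forall (k : nat) (p : 'I_k -> S), injective p -> (forall i, D (p i)) ->
    (P [set omega | forall i, X omega (p i)])%:C =
    \det (\matrix_(i < k, j < k) K (p i) (p j)).

Definition C1_fun (R : realType) (f : R -> R) : Prop :=
  (forall t, derivable f t 1) /\ continuous (derive1 f).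

(* A curve is a map on R of which only the restriction to [0, 1] matters. It is
   piecewise C^1 if [0, 1] is cut into finitely many closed intervals on each
   of which it agrees with a C^1 map; in particular it is continuous. *)
Definition piecewise_C1 (R : realType) (g : R -> R[i]) : Prop :=
  exists s : seq R,
    [/\ path <%R 0 s, last 0 s = 1
      & forall j, (j < size s)%N -> exists h : R -> R[i],
          [/\ C1_fun (fun t => complex.Re (h t)), C1_fun (fun t => complex.Im (h t))
            & forall t, nth 0 (0 :: s) j <= t <= nth 0 s j -> g t = h t]].

Definition cderive (R : realType) (g : R -> R[i]) (t : R) : R[i] :=
  derive1 (fun u => complex.Re (g u)) t +i* derive1 (fun u => complex.Im (g u)) t.

Definition cintegral01 (R : realType) (F : R -> R[i]) : R[i] :=
  Rintegral lebesgue_measure `[0%R, 1%R] (fun t => complex.Re (F t)) +i*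
  Rintegral lebesgue_measure `[0%R, 1%R] (fun t => complex.Im (F t)).

(* For a piecewise C^1 curve, the finitely many break points, where [cderive]
   takes irrelevant values, do not affect the integral. *)
Definition contour_integral (R : realType) (g : R -> R[i]) (f : R[i] -> R[i]) :
    R[i] :=
  cintegral01 (fun t => f (g t) * cderive g t).

Definition two_pi_i (R : realType) : R[i] := 0 +i* (2 * pi).

Definition off_curve (R : realType) (g : R -> R[i]) (a : R[i]) : Prop :=
  forall t : R, 0 <= t <= 1 -> g t != a.

Definition winding (R : realType) (g : R -> R[i]) (a : R[i]) : R[i] :=
  (two_pi_i R)^-1 * contour_integral g (fun w => (w - a)^-1).

(* A simple closed piecewise C^1 curve, counterclockwise oriented. Orientation
   is expressed as in Conway, Functions of One Complex Variable: the winding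
   number around every point off the curve is 0 or 1, and the inside of the
   curve consists of the points around which it is 1. *)
Definition ccw_contour (R : realType) (g : R -> R[i]) : Prop :=
  [/\ piecewise_C1 g, g 0 = g 1,
      forall s t : R, 0 <= s < 1 -> 0 <= t < 1 -> g s = g t -> s = t
    & forall a, off_curve g a -> winding g a = 0 \/ winding g a = 1].

Definition encloses (R : realType) (g : R -> R[i]) (a : R[i]) : Prop :=
  off_curve g a /\ winding g a = 1.

(* The point lies strictly outside; points on the curve are excluded too, as
   the integrands may have poles there. *)
Definition avoids (R : realType) (g : R -> R[i]) (a : R[i]) : Prop :=
  off_curve g a /\ winding g a = 0.

Definition encloses_curve (R : realType) (g h : R -> R[i]) : Prop :=
  forall t : R, 0 <= t <= 1 -> encloses g (h t).

(* Z and Z' are the z-contours of the first and of the second double integral;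
   the constraints coming from beta depend on x2 only. *)
Definition Z_contour (R : realType) (n : nat) (beta : n.-tuple int)
    (x2 : int) (g : R -> R[i]) : Prop :=
  [/\ ccw_contour g,
      forall b : int, b \in beta -> x2 <= b -> encloses g b%:~R
    & forall b : int, b \in beta -> b <= x2 - 1 -> avoids g b%:~R].

Definition Z'_contour (R : realType) (n : nat) (beta : n.-tuple int)
    (x2 : int) (g : R -> R[i]) : Prop :=
  [/\ ccw_contour g,
      forall b : int, b \in beta -> b < x2 -> encloses g b%:~R
    & forall b : int, b \in beta -> x2 <= b -> avoids g b%:~R].

(* [gz] is the z-contour that the w-contour [g] has to enclose. *)
Definition W_contour (R : realType) (n : nat) (p1 : int * nat)
    (gz g : R -> R[i]) : Prop :=
  [/\ ccw_contour g,
      forall k : int, k \in zrange (p1.1 + p1.2%:Z - n%:Z) p1.1 ->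
        encloses g k%:~R
    & encloses_curve g gz].

Definition red_integrand (R : realType) (n : nat) (beta : n.-tuple int)
    (p1 p2 : int * nat) (z w : R[i]) : R[i] :=
  (\prod_(k <- zrange (p2.1 + p2.2%:Z - n%:Z) (p2.1 - 1)) (z - k%:~R)) /
  (\prod_(k <- zrange (p1.1 + p1.2%:Z - n%:Z) p1.1) (w - k%:~R)) *
  (w - z)^-1 *
  \prod_(i < n) ((w - (tnth beta i)%:~R) / (z - (tnth beta i)%:~R)).

Definition red_double_integral (R : realType) (n : nat) (beta : n.-tuple int)
    (p1 p2 : int * nat) (gz gw : R -> R[i]) : R[i] :=
  ((two_pi_i R) ^+ 2)^-1 *
  contour_integral gz (fun z =>
    contour_integral gw (fun w => red_integrand beta p1 p2 z w)).

(* The contours may depend on the pair of points; W goes with Z, W' with Z'. *)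
Definition K_red (R : realType) (n : nat) (beta : n.-tuple int)
    (Z W Z' W' : int * nat -> int * nat -> R -> R[i]) (p1 p2 : int * nat) :
    R[i] :=
  - ((p1.1 < p2.1)%R%:R * red_double_integral beta p1 p2 (Z p1 p2) (W p1 p2))
  + (p2.1 <= p1.1)%R%:R * red_double_integral beta p1 p2 (Z' p1 p2) (W' p1 p2).

(* Main.v *)
(* Let [L] be the smallest entry of the top row [beta]. The arrays all of whose
   points of a finite set [S] are red are counted by a determinant of numbers of
   up-right lattice paths avoiding [S], from the sources [(L, i)] to the points
   [(beta_j, n)]. Avoiding [S] perturbs the matrix of unrestricted path counts by
   finite rank, so two block reductions turn the ratio of the two determinants
   into the determinant over [S] of
     phi(s, t) - sum_j phi(s, (beta_j, n)) c_j(t),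
   where [phi] counts lattice paths and [c] solves a linear system. With
   [B = prod_j (X - beta_j)] and [Q_t] the quotient of [B] by the polynomial in the
   denominator of the [w]-integrand, [c_j(t)] is a factorial times
   [Q_t(beta_j) / B'(beta_j)]; this rests on the Chu-Vandermonde identity for
   rising factorials. Finally, the [w]-integral equals [Q] up to a factor that does
   not depend on [w], because the [w]-contour encloses all poles, and the
   [z]-integral is the sum of the residues at the enclosed [beta_j]. *)
Require Import Defs.
From mathcomp Require Import fingroup perm measurable_realfun ring zify.

Set Implicit Arguments.
Unset Strict Implicit.
Unset Printing Implicit Defensive.

Import Order.TTheory GRing.Theory Num.Theory.
Import numFieldNormedType.Exports.

Local Open Scope classical_set_scope.
Local Open Scope ring_scope.
Local Open Scope complex_scope.

(** * Residues and rising factorials *)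

(** Join [y^(m)_j] to [y^(m+1)_j] by a step up and a run to the right, and start the j-th path at
    [(L, j)]. At level [m] the paths cover the intervals from [y^(m-1)_i] to [y^(m)_i] and from [L]
    to [y^(m)_m]; among the points with [x >= L], the red ones are exactly the uncovered ones. So
    redness is avoidance.

    The system for [c] has a closed solution because [f -> sum_j f(beta_j) / B'(beta_j)] reads off
    the top coefficient of a polynomial of degree below [n]. Where nonzero, path counts into the top
    row are, up to a constant, rising factorials in [beta_j], and for this pairing quotients of [B]
    are dual to rising factorials. The sources sit at [L <= beta_j], so for them the sums run over
    the whole top row.

    All integrands are rational, and partial fractions reduce the integrals to winding numbers,
    which the contours prescribe. The obstacle: the z-contour may run through an integer in the
    denominator of the w-integrand, where two poles in [w] collide. A simple curve meets these
    integers only finitely often, so the z-integral does not notice. *)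

Lemma lagrange_interpolation (F : fieldType) (a : seq F) (P : {poly F}) :
  uniq a -> (size P <= size a)%N ->
  P = \sum_(u <- a) (P.[u] / \prod_(v <- a | v != u) (u - v)) *:
        \prod_(v <- a | v != u) ('X - v%:P).
Proof.
move=> ua sP; apply/eqP; rewrite -subr_eq0; apply/eqP.
set S := \sum_(u <- a) _.
have szprod u : u \in a ->
    size (\prod_(v <- a | v != u) ('X - v%:P)) = size a.
  move=> ina; rewrite -big_filter size_prod_XsubC size_filter.
  have := count_predC (pred1 u) a; rewrite count_uniq_mem // ina add1n => <-.
  by [].
apply: (@roots_geq_poly_eq0 _ _ a) => //; last first.
  apply: leq_trans (size_polyD _ _) _; rewrite geq_max sP size_polyN /=.
  rewrite /S big_seq.
  elim/big_ind: _ => [|p q hp hq|u ina]; first by rewrite size_poly0.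
    by apply: leq_trans (size_polyD _ _) _; rewrite geq_max hp hq.
  by apply: leq_trans (size_scale_leq _ _) _; rewrite szprod.
apply/allP => w wa; rewrite rootE hornerD hornerN horner_sum.
rewrite (bigD1_seq w) //= [X in _ - (_ + X)]big_seq_cond.
rewrite [X in _ - (_ + X)]big1 ?addr0; last first.
  move=> u /andP[ina uw]; rewrite hornerZ horner_prod.
  apply/eqP; rewrite mulf_eq0 prodf_seq_eq0; apply/orP; right.
  by apply/hasP; exists w => //=; rewrite eq_sym uw hornerXsubC subrr eqxx.
rewrite hornerZ horner_prod.
under [X in _ * X]eq_bigr do rewrite hornerXsubC.
rewrite divfK ?subrr //; rewrite prodf_seq_neq0; apply/allP => v va.
by apply/implyP => vw; rewrite subr_eq0 eq_sym.
Qed.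

(* The sum of the residues of P / prod (X - v). *)
Lemma sum_residues (F : fieldType) (a : seq F) (P : {poly F}) :
  uniq a -> (size P <= size a)%N ->
  \sum_(u <- a) P.[u] / \prod_(v <- a | v != u) (u - v) = P`_(size a).-1.
Proof.
move=> ua sP; rewrite [in RHS](lagrange_interpolation ua sP) coef_sum.
rewrite big_seq [RHS]big_seq; apply: eq_bigr => u ina; rewrite coefZ.
rewrite [X in _ = _ * X](_ : _ = 1) ?mulr1 //.
rewrite -big_filter.
set s := [seq v <- a | v != u].
have -> : (size a).-1 = (size (\prod_(v <- s) ('X - v%:P))).-1.
  rewrite size_prod_XsubC size_filter.
  have := count_predC (pred1 u) a; rewrite count_uniq_mem // ina add1n => <-.
  by [].
by apply/monicP; rewrite monic_prod_XsubC.
Qed.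

(** Over a ring, since it is used both for field elements and for the polynomials
    [rising ('X - x%:P) s], the basis in which path counts are expanded. *)
Definition rising (A : comNzRingType) (x : A) (s : nat) : A :=
  \prod_(i < s) (x + i%:R).

Lemma risingS (A : comNzRingType) (x : A) (s : nat) :
  rising x s.+1 = rising x s * (x + s%:R).
Proof. by rewrite /rising big_ord_recr. Qed.

Lemma rising_add (A : comNzRingType) (x : A) (s t : nat) :
  rising x (s + t) = rising x s * rising (x + s%:R) t.
Proof.
rewrite /rising big_split_ord /=; congr (_ * _).
by apply: eq_bigr => i _; rewrite natrD addrA.
Qed.

(** Chu-Vandermonde. The new factor [x + y + s] splits as [(x + (s - t)) + (y + t)], each half
    lengthening one of the two rising factorials, and Pascal's rule recombines the terms. *)
Lemma rising_vandermonde (A : comNzRingType) (x y : A) (s : nat) :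
  rising (x + y) s =
  \sum_(t < s.+1) (rising x (s - t) * rising y t) *+ 'C(s, t).
Proof.
elim: s => [|s IH].
  by rewrite big_ord1 /rising !big_ord0 mulr1.
rewrite risingS IH mulr_suml.
transitivity (\sum_(t < s.+1) ((rising x (s.+1 - t) * rising y t) *+ 'C(s, t)
    + (rising x (s - t) * rising y t.+1) *+ 'C(s, t))).
  apply: eq_bigr => t _; have ts : (t <= s)%N by rewrite -ltnS.
  rewrite mulrnAl -mulrnDl subSn // !risingS; congr (_ *+ _).
  have -> : s%:R = (s - t)%:R + t%:R :> A by rewrite -natrD subnK.
  ring.
rewrite big_split /= [RHS]big_ord_recl /= bin0.
under [in RHS]eq_bigr => t _ do rewrite /bump /= add1n binS mulrnDr subSS.
rewrite big_split /= addrA; congr (_ + _).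
rewrite big_ord_recl /= bin0; congr (_ + _).
rewrite [in RHS]big_ord_recr /= bin_small // mulr0n addr0.
by apply: eq_bigr => t _; rewrite /bump /= add1n subSS.
Qed.

Lemma size_rising_poly (F : fieldType) (x : F) (s : nat) :
  size (rising ('X - x%:P) s) = s.+1.
Proof.
have -> : rising ('X - x%:P) s = \prod_(i <- enum 'I_s) ('X - (x - i%:R)%:P).
  rewrite big_enum /=; apply: eq_bigr => i _.
  by rewrite polyCB opprB polyC_natr addrCA addrC.
by rewrite size_prod_XsubC size_enum_ord.
Qed.

Lemma monic_rising_poly (F : fieldType) (x : F) (s : nat) :
  rising ('X - x%:P) s \is monic.
Proof.
have -> : rising ('X - x%:P) s = \prod_(i <- enum 'I_s) ('X - (x - i%:R)%:P).
  rewrite big_enum /=; apply: eq_bigr => i _.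
  by rewrite polyCB opprB polyC_natr addrCA addrC.
exact: monic_prod_XsubC.
Qed.

Lemma monic_coef_top (F : fieldType) (p : {poly F}) k :
  p \is monic -> size p = k.+1 -> p`_k = 1.
Proof. by move=> /monicP; rewrite /lead_coef => <- ->. Qed.

(** Duality between rising factorials and quotients of [B]. For [t <= r] the product is monic of
    degree [size b - 1 - (r - t)], so its top coefficient is 1 exactly when [t = r]; for [t > r] it
    reduces modulo [B] to a degree below [size b - 1]. *)
Lemma residues_rising (F : fieldType) (b : seq F) (x : F) (r t : nat) :
  uniq b -> (r < size b)%N -> (t < size b)%N ->
  let B := \prod_(v <- b) ('X - v%:P) in
  let Q := B %/ rising ('X - x%:P) r.+1 in
  \sum_(u <- b) ((rising ('X - x%:P) t).[u] * Q.[u])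
     / \prod_(v <- b | v != u) (u - v) = (t == r)%:R.
Proof.
move=> ub rn tn B Q.
set D := rising ('X - x%:P) r.+1 in Q *.
have sB : size B = (size b).+1 by rewrite /B size_prod_XsubC.
have mB : B \is monic by apply: monic_prod_XsubC.
have sD : size D = r.+2 by exact: size_rising_poly.
have mD : D \is monic by exact: monic_rising_poly.
have D0 : D != 0 by exact: monic_neq0.
have sQ : size Q = (size b - r)%N by rewrite size_divp // sB sD /= subSS.
have sQ' : size Q = (size b - r).-1.+1 by rewrite sQ prednK // subn_gt0.
have BE : B = Q * D + B %% D by exact: divp_eq.
have sM : (size (B %% D)%R <= r.+1)%N by rewrite -ltnS -sD ltn_modp.
have Q0 : Q != 0 by rewrite -size_poly_gt0 sQ'.
have mQ : Q \is monic.
  have := monicP mB; rewrite BE lead_coefDl.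
    by rewrite lead_coef_Mmonic // => /monicP.
  by rewrite size_Mmonic // sQ sD (leq_ltn_trans sM) //; lia.
have [tr|rt] := leqP t r.
  under eq_bigr => u _ do rewrite -hornerM.
  have sP : size (rising ('X - x%:P) t * Q) = (t + (size b - r))%N.
    by rewrite size_monicM ?monic_rising_poly // size_rising_poly sQ.
  have mP : rising ('X - x%:P) t * Q \is monic by rewrite monicMl ?monic_rising_poly.
  rewrite sum_residues // ?sP; last by lia.
  have [e|ntr] := eqVneq t r.
    by apply: monic_coef_top => //; rewrite sP; lia.
  by rewrite nth_default // sP; lia.
pose A := rising ('X - x%:P + (r.+1)%:R) (t - r.+1).
have tE : rising ('X - x%:P) t = D * A by rewrite /D /A -rising_add subnKC.
have sA : size A = (t - r.+1).+1.
  have -> : A = rising ('X - (x - r.+1%:R)%:P) (t - r.+1).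
    by rewrite polyCB opprB polyC_natr addrA addrAC.
  exact: size_rising_poly.
(* [D * Q = B - B %% D] and [B] vanishes at every node, so only [- A * (B %% D)], of degree at most
   [t - 1], remains. *)
transitivity (\sum_(u <- b) (- (A * (B %% D)%R)).[u] / \prod_(v <- b | v != u) (u - v)).
  rewrite big_seq [RHS]big_seq; apply: eq_bigr => u ub'; congr (_ / _).
  have Bu : B.[u] = 0 by apply/rootP; rewrite root_prod_XsubC.
  rewrite tE -hornerM.
  have -> : D * A * Q = A * B - A * (B %% D) by rewrite {1}BE; ring.
  by rewrite hornerD hornerM Bu mulr0 add0r.
have sAM : (size (- (A * (B %% D)%R)) <= (size b).-1)%N.
  rewrite size_polyN; apply: leq_trans (size_polyMleq _ _) _.
  rewrite sA addSn /=; apply: leq_trans (leq_add (leqnn _) sM) _.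
  by rewrite subnK // -ltnS prednK // (leq_trans _ tn).
rewrite sum_residues //; last exact: leq_trans sAM (leq_pred _).
by rewrite nth_default // gtn_eqF.
Qed.

(** Chu-Vandermonde with [u - a + 1 = (x - a + 1) + (u - x)] expands in the basis centred at [x],
    and duality keeps the single coefficient [t = r]. For [r > s] there is no such term and the
    binomial is 0. *)
Lemma residues_shifted_rising (F : fieldType) (b : seq F) (x a : F) (r s : nat) :
  uniq b -> (r < size b)%N -> (s < size b)%N ->
  let B := \prod_(v <- b) ('X - v%:P) in
  let Q := B %/ rising ('X - x%:P) r.+1 in
  \sum_(u <- b) (rising (u - a + 1) s * Q.[u])
     / \prod_(v <- b | v != u) (u - v) =
  rising (x - a + 1) (s - r) *+ 'C(s, r).
Proof.
move=> ub rn sn B Q.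
transitivity (\sum_(t < s.+1) \sum_(u <- b)
    (rising (x - a + 1) (s - t) *+ 'C(s, t)) *
    ((rising ('X - x%:P) t).[u] * Q.[u] / \prod_(v <- b | v != u) (u - v))).
  rewrite exchange_big; apply: eq_bigr => u _.
  have -> : u - a + 1 = (x - a + 1) + (u - x) by ring.
  rewrite rising_vandermonde !mulr_suml; apply: eq_bigr => t _ /=.
  have -> : (rising ('X - x%:P) t).[u] = rising (u - x) t.
    rewrite /rising horner_prod; apply: eq_bigr => i _.
    by rewrite hornerD hornerXsubC -polyC_natr hornerC.
  by rewrite -!mulrnAl !mulrA.
transitivity (\sum_(t < s.+1)
    (rising (x - a + 1) (s - t) *+ 'C(s, t)) * (t == r :> nat)%:R).
  apply: eq_bigr => t _; rewrite -mulr_sumr (residues_rising x ub rn) //.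
  exact: leq_trans (ltn_ord t) sn.
have [rs|sr] := leqP r s.
  rewrite (bigD1 (Ordinal (rs : (r < s.+1)%N))) //= eqxx mulr1 big1 ?addr0 //.
  by move=> t; rewrite -val_eqE /= => /negPf ->; rewrite mulr0.
rewrite bin_small // mulr0n big1 // => t _.
by rewrite ltn_eqF ?mulr0 // (leq_ltn_trans _ sr) // -ltnS.
Qed.

(** This evaluates the w-integral: the left side is the sum of all residues of [P / ((X - z) D)]. At
    the nodes [P] agrees with [Q(z) D + P %% D], which has degree at most [size a] and coefficient
    [Q(z)] there. *)
Lemma residues_quotient (F : fieldType) (a : seq F) (P : {poly F}) (z : F) :
  uniq (z :: a) ->
  \sum_(u <- z :: a) P.[u] / \prod_(v <- z :: a | v != u) (u - v) =
  (P %/ \prod_(v <- a) ('X - v%:P)).[z].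
Proof.
move=> uza; have ua : uniq a by case/andP: uza.
set D := \prod_(v <- a) _; set Q := P %/ D.
have mD : D \is monic by exact: monic_prod_XsubC.
have sD : size D = (size a).+1 by exact: size_prod_XsubC.
have PE : P = Q * D + P %% D by exact: divp_eq.
have sM : (size (P %% D)%R <= size a)%N.
  by rewrite -ltnS -sD ltn_modp monic_neq0.
transitivity (\sum_(u <- z :: a)
    (Q.[z] *: D + P %% D).[u] / \prod_(v <- z :: a | v != u) (u - v)).
  rewrite big_seq [RHS]big_seq; apply: eq_bigr => u; rewrite inE => uz.
  congr (_ / _); rewrite {1}PE !hornerE /=; case/orP: uz => [/eqP -> //|ua'].
  by have /rootP -> : root D u; rewrite ?root_prod_XsubC // !mulr0.
rewrite sum_residues //=; last first.
  apply: leq_trans (size_polyD _ _) _; rewrite geq_max (leqW sM) andbT.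
  by apply: leq_trans (size_scale_leq _ _) _; rewrite sD.
by rewrite coefD coefZ (monic_coef_top mD sD) mulr1 (nth_default _ sM) addr0.
Qed.

(** * Counting arrays by avoiding lattice paths *)

Lemma zrangeE (a : int) (n : nat) :
  zrange a (a + n%:Z - 1) = [seq a + i%:Z | i <- iota 0 n].
Proof.
rewrite /zrange; congr map; congr iota.
case: n => [|n]; first by case: ifP => //; lia.
case: ifP => [_|]; last by lia.
lia.
Qed.

Lemma zrange_nil (a b : int) : b < a -> zrange a b = [::].
Proof. by move=> ba; rewrite /zrange leNgt ba. Qed.

Lemma zrange_uniq (a b : int) : uniq (zrange a b).
Proof.
by rewrite map_inj_uniq ?iota_uniq // => i j /addrI [].
Qed.

Lemma mem_zrange (a b k : int) : (k \in zrange a b) = (a <= k <= b).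
Proof.
have [ba|ab] := ltP b a; first by rewrite zrange_nil // in_nil; lia.
have -> : b = a + (`|(b - a)%R|%N.+1)%:Z - 1 by lia.
rewrite zrangeE; apply/mapP/idP => [[j hj ->]|kab].
  by move: hj; rewrite mem_iota; lia.
by exists (`|(k - a)%R|%N); rewrite ?mem_iota; lia.
Qed.

Lemma zrange_cat (a b c : int) : a <= b + 1 -> b <= c ->
  zrange a c = zrange a b ++ zrange (b + 1) c.
Proof.
move=> ab bc.
have [n bE] : exists n : nat, b = a + n%:Z - 1.
  by exists (`|(b + 1 - a)%R|%N); lia.
have [m cE] : exists m : nat, c = b + 1 + m%:Z - 1.
  by exists (`|(c - b)%R|%N); lia.
rewrite {2}cE zrangeE bE zrangeE.
have -> : c = a + (n + m)%:Z - 1 by lia.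
rewrite zrangeE iotaD map_cat; congr (_ ++ _).
transitivity [seq a + i%:Z | i <- [seq (n + j)%N | j <- iota 0 m]].
  by rewrite -iotaDl addn0.
by rewrite -map_comp; apply: eq_map => i /=; lia.
Qed.

Lemma zrange1 (a : int) : zrange a a = [:: a].
Proof. by rewrite /zrange lexx subrr /= addr0. Qed.

Fixpoint cart (T : Type) (s : seq (seq T)) : seq (seq T) :=
  if s is P :: s' then [seq x :: z | x <- P, z <- cart s'] else [:: [::]].

Lemma mem_cart (T : eqType) (x0 : T) (s : seq (seq T)) (z : seq T) :
  z \in cart s <->
  size z = size s /\
  forall j, (j < size s)%N -> nth x0 z j \in nth [::] s j.
Proof.
elim: s z => [|P s IH] z /=.
  by rewrite inE; split=> [/eqP -> //|[/size0nil ->]].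
split=> [/allpairsP [[x t] /= [xP ts ->]]|[]].
  have [st ht] := (IH t).1 ts; split; first by rewrite /= st.
  by case=> [//|j] /= hj; apply: ht.
case: z => [//|x t] /= [st] h.
apply/allpairsP; exists (x, t); split=> //=; first exact: (h 0%N).
by apply/IH; split=> // j; apply: (h j.+1).
Qed.

Lemma cart_uniq (T : eqType) (s : seq (seq T)) :
  all uniq s -> uniq (cart s).
Proof.
elim: s => [//|P s IH] /= /andP[uP us].
by apply: allpairs_uniq; rewrite ?IH // => -[x t] [y u] _ _ /= [-> ->].
Qed.

Lemma sum_cart (F : comNzRingType) (T : eqType) (x0 : T) (s : seq (seq T))
    (f : nat -> T -> F) :
  \sum_(z <- cart s) \prod_(j < size s) f j (nth x0 z j) =
  \prod_(j < size s) \sum_(x <- nth [::] s j) f j x.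
Proof.
elim: s f => [|P s IH] f /=; first by rewrite big_seq1 !big_ord0.
rewrite big_allpairs_dep big_ord_recl /= mulr_suml; apply: eq_bigr => x _.
under eq_bigr => z _ do rewrite big_ord_recl /=.
by rewrite -mulr_sumr (IH (fun j => f j.+1)).
Qed.

(** Multilinearity of the determinant in its columns, each column being a sum over its own list. *)
Lemma det_cart (F : comNzRingType) (T : eqType) (x0 : T) (m : nat)
    (s : seq (seq T)) (f : 'I_m -> T -> F) : size s = m ->
  \sum_(z <- cart s) \det (\matrix_(i < m, j < m) f i (nth x0 z j)) =
  \det (\matrix_(i < m, j < m) \sum_(x <- nth [::] s j) f i x).
Proof.
move=> sm; subst m; under eq_bigr => z _ do rewrite -det_tr.
rewrite -[in RHS]det_tr /determinant exchange_big /=.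
apply: eq_bigr => g _; rewrite -mulr_sumr.
congr (_ * _).
case: s f g => [|P s] f g; first by rewrite /= big_seq1 !big_ord0.
have := sum_cart x0 (P :: s) (fun j => f (g (inord j : 'I_(size s).+1))).
rewrite [X in _ = X -> _](_ : _ = \prod_(j < size (P :: s))
    (\matrix_(i < size (P :: s), j < size (P :: s))
       \sum_(x <- nth [::] (P :: s) j) f i x)^T j (g j)).
  move=> <-; apply: eq_bigr => z _; apply: eq_bigr => j _.
  by rewrite !mxE inord_val.
by apply: eq_bigr => j _; rewrite !mxE inord_val.
Qed.

(** * Lattice paths avoiding a set, and arrays built row by row *)

Definition clear_of (S : pred int) (a b : int) : bool := ~~ has S (zrange a b).

Lemma clear_of_cat (S : pred int) (a b c : int) : a <= b + 1 -> b <= c ->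
  clear_of S a c = clear_of S a b && clear_of S (b + 1) c.
Proof. by move=> ab bc; rewrite /clear_of (zrange_cat ab bc) has_cat negb_or. Qed.

Lemma clear_ofP (S : pred int) (a b : int) :
  reflect (forall x, a <= x <= b -> ~~ S x) (clear_of S a b).
Proof.
apply: (iffP hasPn) => h x; first by rewrite -mem_zrange; apply: h.
by rewrite mem_zrange; apply: h.
Qed.

(* The number of up-right lattice paths from [(L, i + 1)] to [(x, m)] that avoid
   the points [(k, l)] with [S l k]. *)
Fixpoint paths (F : comNzRingType) (L : int) (S : nat -> pred int)
    (i m : nat) (x : int) : F :=
  if m is m'.+1 then
    \sum_(k <- zrange L x | clear_of (S m) k x)
      (paths F L S i m' k + ((i == m') && (k == L))%:R)
  else 0.

Lemma paths_low (F : comNzRingType) (L : int) (S : nat -> pred int)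
    (i m : nat) (x : int) : (m <= i)%N -> paths F L S i m x = 0.
Proof.
elim: m x => [//|m IH] x mi /=; rewrite big1 // => k _.
by rewrite IH ?(ltnW mi) // gtn_eqF // addr0.
Qed.

Lemma paths_left (F : comNzRingType) (L : int) (S : nat -> pred int)
    (i m : nat) : paths F L S i m (L - 1) = 0.
Proof. by case: m => [//|m] /=; rewrite zrange_nil ?big_nil //; lia. Qed.

(** A path reaching [(x, m + 1)] arrives from the left, from below, or starts there. This local
    form, unlike the defining sum over a whole run, can be compared with [lattice_paths_step]. *)
Lemma paths_step (F : comNzRingType) (L : int) (S : nat -> pred int)
    (i m : nat) (x : int) : L <= x ->
  paths F L S i m.+1 x = (~~ S m.+1 x)%:R *
    (paths F L S i m.+1 (x - 1) + paths F L S i m x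
     + ((i == m) && (x == L))%:R).
Proof.
move=> Lx /=.
have zE : zrange L x = zrange L (x - 1) ++ [:: x].
  by rewrite (@zrange_cat L (x - 1) x) ?subrK ?zrange1 //; lia.
rewrite zE big_cat /= big_mkcond big_seq.
rewrite (eq_bigr (fun k => (~~ S m.+1 x)%:R *
   (if clear_of (S m.+1) k (x - 1)
    then paths F L S i m k + ((i == m) && (k == L))%:R else 0))); last first.
  move=> k; rewrite mem_zrange => hk.
  rewrite (@clear_of_cat (S m.+1) k (x - 1) x); [|lia|lia].
  rewrite subrK {2}/clear_of zrange1 /= orbF.
  by case: (clear_of _ _ _); case: (S _ _); rewrite ?mul1r ?mul0r ?mulr0.
rewrite -big_seq -mulr_sumr -big_mkcond -addrA [RHS]mulrDr; congr (_ + _).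
rewrite big_cons big_nil addr0 /clear_of zrange1 /= orbF.
by case: (S _ _); rewrite ?mul1r ?mul0r.
Qed.

(** The j-th list holds the values allowed for the j-th entry of the row below [y]: interlacing
    gives the range, and the run of the j-th path from that entry to the entry of [y] must avoid
    [S]. *)
Definition gaps (S : pred int) (y : seq int) : seq (seq int) :=
  [seq [seq k <- zrange (b.2 + 1) b.1 | clear_of S k b.1]
  | b <- zip y (behead y)].

Definition below (S : pred int) (y : seq int) : seq (seq int) := cart (gaps S y).

(** The runs at level [m] are those between the rows [m - 1] and [m], tested in [gaps], and the run
    of the newest path from its source at [L] to the last entry, tested here. *)
Fixpoint arrays (L : int) (S : nat -> pred int) (m : nat) (y : seq int) :
    seq (seq (seq int)) :=
  if m is m'.+1 then
    if clear_of (S m) L (nth 0 y m') then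
      [seq rcons a y | z <- below (S m) y, a <- arrays L S m' z]
    else [::]
  else [:: [::]].

Lemma size_zip_behead (T : Type) (m : nat) (y : seq T) : size y = m.+1 ->
  size (zip y (behead y)) = m.
Proof. by move=> sy; rewrite size_zip size_behead sy /=; lia. Qed.

Lemma nth_zip_behead (m j : nat) (y : seq int) : size y = m.+1 -> (j < m)%N ->
  nth (0, 0) (zip y (behead y)) j = (nth 0 y j, nth 0 y j.+1).
Proof.
by move=> sy jm; rewrite nth_zip_cond (size_zip_behead sy) jm nth_behead.
Qed.

Lemma nth_gaps (S : pred int) (m j : nat) (y : seq int) :
  size y = m.+1 -> (j < m)%N ->
  nth [::] (gaps S y) j =
  [seq k <- zrange (nth 0 y j.+1 + 1) (nth 0 y j) | clear_of S k (nth 0 y j)].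
Proof.
move=> sy jm; rewrite (nth_map (0, 0)) ?(size_zip_behead sy) //.
by rewrite (nth_zip_behead sy jm).
Qed.

Lemma size_gaps (S : pred int) (m : nat) (y : seq int) : size y = m.+1 ->
  size (gaps S y) = m.
Proof. by move=> sy; rewrite size_map (size_zip_behead sy). Qed.

Lemma mem_below (S : pred int) (m : nat) (y z : seq int) : size y = m.+1 ->
  z \in below S y <->
  size z = m /\ forall j, (j < m)%N ->
    nth 0 y j.+1 < nth 0 z j <= nth 0 y j /\
    clear_of S (nth 0 z j) (nth 0 y j).
Proof.
move=> sy; split=> [/(mem_cart 0)|]; rewrite ?(size_gaps S sy).
  case=> sz h; split=> // j jm; have := h j jm.
  rewrite (nth_gaps S sy jm) mem_filter mem_zrange => /andP[-> hj].
  by split=> //; rewrite -lezD1.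
case=> sz h; apply/(mem_cart 0); rewrite (size_gaps S sy); split=> // j jm.
rewrite (nth_gaps S sy jm) mem_filter mem_zrange.
by have [h1 ->] := h j jm; rewrite lezD1.
Qed.

Lemma below_uniq (S : pred int) (y : seq int) : uniq (below S y).
Proof.
apply: cart_uniq; apply/allP => s /mapP[b _ ->].
exact: filter_uniq (zrange_uniq _ _).
Qed.

(** A run from [k <= a] to [b] is a run from [k] to [a] followed by [a + 1, ..., b]. This relates
    path counts at neighbouring entries of a row and yields the column operation in
    [size_arrays]. *)
Lemma paths_gap (F : comNzRingType) (S : pred int) (L a b : int) (f : int -> F) :
  L <= a <= b ->
  \sum_(k <- zrange L b | clear_of S k b) f k =
  \sum_(k <- zrange (a + 1) b | clear_of S k b) f k
  + (clear_of S (a + 1) b)%:R * \sum_(k <- zrange L a | clear_of S k a) f k.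
Proof.
move=> Lab; rewrite (@zrange_cat L a b) ?big_cat /=; [|lia|lia].
rewrite addrC mulr_sumr; congr (_ + _); rewrite big_mkcond [RHS]big_mkcond /=.
rewrite big_seq [RHS]big_seq; apply: eq_bigr => k; rewrite mem_zrange => hk.
rewrite (@clear_of_cat S k a b); [|lia|lia].
by case: (clear_of S k a); case: (clear_of _ _ _); rewrite ?mul1r ?mul0r.
Qed.

Definition decreasing (m : nat) (y : seq int) : Prop :=
  size y = m /\ forall j, (j.+1 < m)%N -> nth 0 y j.+1 < nth 0 y j.

Lemma decreasing_lt (m : nat) (y : seq int) (i j : nat) :
  decreasing m y -> (i < j)%N -> (j < m)%N -> nth 0 y j < nth 0 y i.
Proof.
case=> _ h; elim: j => [//|j IH]; rewrite ltnS leq_eqVlt => /orP[/eqP <-|ij] jm.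
  exact: h.
exact: lt_trans (h j jm) (IH ij (ltnW jm)).
Qed.

Lemma decreasing_below (S : pred int) (m : nat) (y z : seq int) :
  decreasing m.+1 y -> z \in below S y -> decreasing m z.
Proof.
move=> [sy hy] /(mem_below S z sy) [sz hz]; split=> // j jm.
have [/andP[h1 _] _] := hz j (ltnW jm); have [/andP[_ h2] _] := hz _ jm.
exact: le_lt_trans h2 h1.
Qed.

(** The source with index [m] enters level [m + 1] only at [L], and the interval lies strictly to
    the right of [L]. *)
Lemma sum_source_gap (F : comNzRingType) (L : int) (S : nat -> pred int) (m : nat)
    (P : pred int) (a b : int) : L <= a ->
  \sum_(k <- zrange (a + 1) b | P k)
    (paths F L S m m k + ((m == m) && (k == L))%:R) = 0.
Proof.
move=> La; rewrite big_seq_cond big1 // => k; rewrite mem_zrange => /andP[hk _].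
rewrite paths_low // add0r eqxx /=.
by have /negPf -> : k != L; [lia|].
Qed.

Lemma sum_source (F : comNzRingType) (L : int) (S : nat -> pred int) (m : nat)
    (Q : pred int) (a : int) : L <= a ->
  \sum_(k <- zrange L a | clear_of Q k a)
    (paths F L S m m k + ((m == m) && (k == L))%:R) = (clear_of Q L a)%:R.
Proof.
move=> La; rewrite (@zrange_cat L L a) ?zrange1 //; last by lia.
rewrite big_cat /= sum_source_gap // addr0 big_cons big_nil.
by rewrite paths_low // !eqxx /= add0r addr0; case: (clear_of _ _ _).
Qed.

(* Column j is replaced by (column j) - (a multiple of column j + 1), which turns
   the last row into a multiple of a unit vector. *)
Lemma size_arrays (F : comNzRingType) (L : int) (S : nat -> pred int)
    (m : nat) (y : seq int) :
  decreasing m y -> (forall j, (j < m)%N -> L <= nth 0 y j) ->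
  (size (arrays L S m y))%:R =
  \det (\matrix_(i < m, j < m) paths F L S i m (nth 0 y j)).
Proof.
elim: m y => [|m IH] y dy Ly; first by rewrite det_mx00.
have [sy hy] := dy.
pose f (i : nat) k := paths F L S i m k + ((i == m) && (k == L))%:R.
pose c (j : nat) : F := (clear_of (S m.+1) (nth 0 y j.+1 + 1) (nth 0 y j))%:R.
set M := \matrix_(i, j) _.
pose E : 'M[F]_m.+1 := \matrix_(k, j) ((k == j)%:R - (k == j.+1 :> nat)%:R * c j).
have detE : \det E = 1.
  rewrite det_trig.
    by apply: big1 => i _; rewrite mxE eqxx ltn_eqF // mul0r subr0.
  apply/is_trig_mxP => i j ij; rewrite mxE -val_eqE /= !ltn_eqF ?mul0r ?subr0 //.
  exact: ltnW.
pose N := M *m E.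
have NE (i : 'I_m.+1) (j : 'I_m) : N i (widen_ord (leqnSn m) j) =
    \sum_(k <- nth [::] (gaps (S m.+1) y) j) f i k.
  have jm := ltn_ord j.
  have j1 : (j.+1 < m.+1)%N by [].
  rewrite mxE (bigD1 (widen_ord (leqnSn m) j)) //=.
  rewrite (bigD1 (Ordinal j1)) /=; last by rewrite -val_eqE /= gtn_eqF.
  rewrite big1 ?addr0; last first.
    move=> k /andP[]; rewrite !mxE -!val_eqE /= => /negPf -> /negPf ->.
    by rewrite mul0r subr0 mulr0.
  rewrite !mxE -!val_eqE /= !eqxx (ltn_eqF (ltnSn j)) (gtn_eqF (ltnSn j)).
  rewrite mul0r subr0 mulr1 mul1r sub0r mulrN.
  rewrite (nth_gaps _ sy jm) big_filter.
  rewrite (@paths_gap F (S m.+1) L (nth 0 y j.+1) (nth 0 y j)); last first.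
    by rewrite Ly //=; apply/ltW/hy.
  by rewrite /c mulrC addrK.
have Nlast i : N i ord_max = M i ord_max.
  rewrite mxE (bigD1 ord_max) //= big1 ?addr0; last first.
    move=> k; rewrite !mxE -val_eqE /= => /negPf ->.
    by rewrite (ltn_eqF (ltn_ord k)) mul0r subr0 mulr0.
  by rewrite !mxE eqxx (ltn_eqF (ltnSn m)) mul0r subr0 mulr1.
have Nm (j : 'I_m.+1) : N ord_max j = (j == ord_max)%:R *
     (clear_of (S m.+1) L (nth 0 y m))%:R.
  have [->|jm] := eqVneq j ord_max.
    by rewrite Nlast mxE /= mul1r sum_source // Ly.
  have jm' : (j < m)%N.
    by rewrite ltn_neqAle -ltnS ltn_ord andbT; move: jm; rewrite -val_eqE.
  have -> : j = widen_ord (leqnSn m) (Ordinal jm') by exact/val_inj.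
  rewrite NE (nth_gaps _ sy jm') big_filter sum_source_gap ?mul0r //.
  exact: Ly.
have -> : \det M = \det N by rewrite det_mulmx detE mulr1.
rewrite (expand_det_row N ord_max) (bigD1 ord_max) //= big1 ?addr0; last first.
  by move=> j /negPf jm; rewrite Nm jm !mul0r.
rewrite Nm eqxx mul1r.
case: ifP => cl; last by rewrite mul0r.
rewrite mul1r /cofactor -signr_odd oddD addbb expr0 mul1r.
rewrite size_allpairs_dep sumnE big_map natr_sum.
(* Columns of gap sums expand into a sum over the choices of one point per gap, that is, over the
   admissible rows below [y]. *)
transitivity (\sum_(z <- below (S m.+1) y)
    \det (\matrix_(i < m, j < m) f i (nth 0 z j))).
  rewrite big_seq [RHS]big_seq; apply: eq_bigr => z zy.
  have dz := decreasing_below dy zy; rewrite IH //.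
    congr (\det _); apply/matrixP => i j; rewrite !mxE /f (ltn_eqF (ltn_ord i)).
    by rewrite addr0.
  move=> j jm; have [_ hz] := (mem_below _ _ sy).1 zy.
  by have [/andP[h1 _] _] := hz j jm; apply: le_trans (ltW h1); exact: Ly.
rewrite /below (det_cart 0 (fun i : 'I_m => f i) (size_gaps _ sy)); congr (\det _).
apply/matrixP => i j; rewrite mxE [RHS]mxE [RHS]mxE.
have -> : lift ord_max j = widen_ord (leqnSn m) j.
  by apply/val_inj; exact: lift_max.
by rewrite NE lift_max.
Qed.

Lemma arrays_last (L : int) (S : nat -> pred int) (m : nat) (y : seq int)
    (a : seq (seq int)) : size y = m -> a \in arrays L S m y ->
  last [::] a = y.
Proof.
case: m => [|m] /=; first by rewrite inE => /size0nil -> /eqP ->.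
move=> _; case: ifP => // _ /allpairsPdep [z [b [_ _ ->]]].
by rewrite last_rcons.
Qed.

(** The chosen row [z] is the last row of the smaller array, so different choices give different
    arrays. *)
Lemma arrays_uniq (L : int) (S : nat -> pred int) (m : nat) (y : seq int) :
  size y = m -> uniq (arrays L S m y).
Proof.
elim: m y => [//|m IH] y sy /=; case: ifP => // _.
have sz z : z \in below (S m.+1) y -> size z = m by case/(mem_below _ _ sy).
apply: allpairs_uniq_dep; first exact: below_uniq.
  by move=> z /sz; apply: IH.
move=> t t' /allpairsPdep[z [a [zy az ->]]] /allpairsPdep[z' [a' [zy' az' ->]]] /=.
move=> /rcons_inj [aa']; move: az'; rewrite -aa' => az'.
by rewrite -(arrays_last (sz _ zy) az) -(arrays_last (sz _ zy') az').
Qed.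

Lemma mem_arrays (L : int) (S : nat -> pred int) (m : nat) (y : seq int)
    (a : seq (seq int)) : size y = m ->
  a \in arrays L S m y <->
  [/\ shape a = iota 1 m, last [::] a = y,
      forall l i, (l.+1 < m)%N -> (i <= l)%N ->
        nth 0 (nth [::] a l.+1) i.+1 < nth 0 (nth [::] a l) i
          <= nth 0 (nth [::] a l.+1) i,
      forall l, (l < m)%N -> clear_of (S l.+1) L (nth 0 (nth [::] a l) l)
    & forall l i, (l.+1 < m)%N -> (i <= l)%N ->
        clear_of (S l.+2) (nth 0 (nth [::] a l) i) (nth 0 (nth [::] a l.+1) i)].
Proof.
elim: m y a => [|m IH] y a sy.
  rewrite inE; split=> [/eqP -> | [ha _ _ _ _]]; last by apply/eqP; case: a ha.
  by split=> //; rewrite (size0nil sy).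
have iotaSr : iota 1 m.+1 = rcons (iota 1 m) m.+1.
  by rewrite -[in LHS](addn1 m) iotaD cats1 add1n.
split.
  rewrite /=; case: ifP => // cl /allpairsPdep [z [b [zy bz ->]]].
  have [sz hz] := (mem_below _ _ sy).1 zy.
  have [hsh hl h1 h2 h3] := (IH z b sz).1 bz.
  have sb : size b = m by rewrite -(size_map size b) -/(shape b) hsh size_iota.
  have last_b l : l.+1 = m -> nth [::] b l = z.
    by move=> lm; rewrite -hl -nth_last sb -lm.
  rewrite last_rcons; split=> //.
  - by rewrite -[RHS]/(iota 1 m.+1) iotaSr -hsh -sy /shape map_rcons.
  - move=> l i; rewrite ltnS leq_eqVlt => /orP[/eqP lm|lm] il.
      rewrite !nth_rcons sb lm eqxx ltnn leqnn (last_b _ lm).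
      by apply: (hz i _).1; rewrite -lm.
    by rewrite !nth_rcons sb lm (ltnW lm); apply: h1.
  - move=> l; rewrite ltnS leq_eqVlt => /orP[/eqP ->|lm].
      by rewrite nth_rcons sb ltnn eqxx.
    by rewrite nth_rcons sb lm; apply: h2.
  - move=> l i; rewrite ltnS leq_eqVlt => /orP[/eqP lm|lm] il.
      rewrite !nth_rcons sb lm eqxx ltnn leqnn (last_b _ lm).
      by apply: (hz i _).2; rewrite -lm.
    by rewrite !nth_rcons sb lm (ltnW lm); apply: h3.
case: (lastP a) => [[//]|b y'].
rewrite last_rcons => -[hsh e h1 h2 h3]; subst y'.
move: hsh; rewrite iotaSr /shape map_rcons => /rcons_inj [hsh _].
have sb : size b = m by rewrite -(size_map size b) hsh size_iota.
have nb l : (l < m)%N -> nth [::] (rcons b y) l = nth [::] b l.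
  by move=> lm; rewrite nth_rcons sb lm.
have ny : nth [::] (rcons b y) m = y by rewrite nth_rcons sb ltnn eqxx.
have := h2 m (ltnSn m); rewrite ny /= => ->; apply/allpairsPdep.
exists (last [::] b), b.
have lb l : l.+1 = m -> last [::] b = nth [::] b l.
  by move=> lm; rewrite -nth_last sb -lm.
have sz : size (last [::] b) = m.
  case: m {IH sy iotaSr h1 h2 h3 nb ny} hsh sb lb => [|m] hsh sb lb.
    by rewrite (size0nil sb).
  rewrite (lb m) // -(nth_map _ 0%N size) ?sb // hsh nth_iota // add1n.
split=> //.
  apply/(mem_below _ _ sy); split=> // j jm.
  have m0 : m.-1.+1 = m by rewrite prednK // (leq_trans _ jm).
  have jm' : (j <= m.-1)%N by rewrite -ltnS m0.
  have := h1 m.-1 j; have := h3 m.-1 j.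
  rewrite m0 ny nb ?m0 // -(lb _ m0) => h h'.
  by split; [apply: h'|apply: h].
apply/(IH _ _ sz); split=> // [l i lm il|l lm|l i lm il].
- by rewrite -!nb ?(ltnW lm) //; apply: h1 => //; apply: ltnW.
- by rewrite -nb //; apply: h2; apply: ltnW.
- by rewrite -!nb ?(ltnW lm) //; apply: h3 => //; apply: ltnW.
Qed.

(** * Reduction to a determinant over the red points *)

(** Counts unrestricted up-right paths from [s] to [v] by choosing which unit steps go up. The start
    is arbitrary, so it serves for the sources and for the points [p s] alike. *)
Definition lattice_paths (F : comNzRingType) (s v : int * nat) : F :=
  if (s.1 <= v.1) && (s.2 <= v.2)%N
  then 'C(`|(v.1 - s.1)%R|%N + (v.2 - s.2), v.2 - s.2)%:R else 0.

Lemma lattice_paths_step (F : comNzRingType) (s : int * nat) (x : int) (m : nat) :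
  lattice_paths F s (x, m.+1) =
  lattice_paths F s (x - 1, m.+1) + lattice_paths F s (x, m)
  + (s == (x, m.+1))%:R.
Proof.
case: s => a l; rewrite /lattice_paths xpair_eqE /=.
have [ax|ax|<-] := ltgtP a x.
- have -> : a <= x - 1 by lia.
  have [d dE] : exists d, `|(x - a)%R|%N = d.+1.
    by exists (`|(x - a)%R|%N.-1); lia.
  have -> : `|(x - 1 - a)%R|%N = d by lia.
  rewrite dE /= addr0; have [lm|lm|->] := ltngtP l m.+1.
  + rewrite (_ : (l <= m)%N = true) //.
    by rewrite subSn // addnS binS natrD addSnnS.
  + by rewrite (_ : (l <= m)%N = false) ?addr0 // leqNgt (ltnW lm).
  + by rewrite ltnn subnn !bin0 addr0.
- have -> : (a <= x - 1) = false by lia.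
  by rewrite !addr0.
- have -> : (a <= a - 1) = false by lia.
  rewrite subrr /= add0r; have [lm|lm|->] := ltngtP l m.+1.
  + by rewrite (_ : (l <= m)%N = true) // !add0n !binn addr0.
  + by rewrite (_ : (l <= m)%N = false) ?addr0 // leqNgt (ltnW lm).
  + by rewrite ltnn subnn !bin0 add0r.
Qed.

Lemma lattice_paths_start (F : comNzRingType) (s : int * nat) (x : int) :
  (0 < s.2)%N -> lattice_paths F s (x, 0%N) = 0.
Proof. by move=> s0; rewrite /lattice_paths /= leqn0 gtn_eqF // andbF. Qed.

Lemma lattice_paths_left (F : comNzRingType) (s : int * nat) (x : int) (m : nat) :
  x < s.1 -> lattice_paths F s (x, m) = 0.
Proof. by move=> xs; rewrite /lattice_paths /= leNgt xs. Qed.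

(** Uniqueness for the path recursion, with zero data on level 0 and on the column left of [L]; the
    induction goes up the levels and to the right within each. *)
Lemma path_recursion0 (F : comNzRingType) (L : int) (d : nat -> int -> F) :
  (forall x, d 0%N x = 0) -> (forall m, d m (L - 1) = 0) ->
  (forall m x, L <= x -> d m.+1 x = d m.+1 (x - 1) + d m x) ->
  forall m x, L <= x -> d m x = 0.
Proof.
move=> d0 dL dS; elim=> [//|m IH] x Lx.
suff H u : d m.+1 (L - 1 + u%:Z) = 0.
  by have -> : x = L - 1 + `|(x - (L - 1))%R|%N%:Z; [lia|].
elim: u => [|u IHu]; first by rewrite addr0.
rewrite dS; last by lia.
rewrite IH; last by lia.
by rewrite addr0 -[RHS]IHu; congr (d _ _); lia.
Qed.

Definition occupied (k : nat) (p : 'I_k -> int * nat) (l : nat) (x : int) : bool :=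
  [exists s, p s == (x, l)].

(* [g i s] counts the paths whose first point among the [p s] is [p s]. *)
Lemma paths_first_hit (F : comNzRingType) (L : int) (k : nat)
    (p : 'I_k -> int * nat) :
  injective p -> (forall s, L <= (p s).1) -> (forall s, (0 < (p s).2)%N) ->
  exists g : nat -> 'I_k -> F, forall i m x, L <= x ->
    paths F L (occupied p) i m x =
    lattice_paths F (L, i.+1) (x, m)
    - \sum_s g i s * lattice_paths F (p s) (x, m).
Proof.
move=> pI pL p0; set S := occupied p.
(* [pre i m x] counts the paths arriving at [(x, m + 1)] that avoid [S] before, whether or not that
   point itself lies in [S]. *)
pose pre i m x := paths F L S i m.+1 (x - 1) + paths F L S i m x
  + ((i == m) && (x == L))%:R.
exists (fun i s => pre i (p s).2.-1 (p s).1) => i m x Lx.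
apply/eqP; rewrite -subr_eq0; apply/eqP.
pose d m x := paths F L S i m x - (lattice_paths F (L, i.+1) (x, m)
  - \sum_s pre i (p s).2.-1 (p s).1 * lattice_paths F (p s) (x, m)).
apply: (@path_recursion0 F L d) Lx => {m x} [x|m|m x Lx]; rewrite /d.
- rewrite /= lattice_paths_start // big1 ?subrr ?subr0 // => s _.
  by rewrite lattice_paths_start ?mulr0.
- rewrite paths_left lattice_paths_left /=; last by lia.
  rewrite big1 ?subrr ?subr0 // => s _.
  by rewrite lattice_paths_left ?mulr0 //; have := pL s; lia.
(* At a forbidden point the arriving paths are cancelled, once because [p] is injective; elsewhere
   every summand is 0. *)
have hit : paths F L S i m.+1 x =
    pre i m x - \sum_s pre i (p s).2.-1 (p s).1 * (p s == (x, m.+1))%:R.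
  rewrite paths_step // -/(pre i m x); have [/existsP[s /eqP ps]|] := boolP (S m.+1 x).
    rewrite mul0r (bigD1 s) //= ps eqxx mulr1 big1 ?addr0 ?subrr //.
    move=> t ts; rewrite -ps (inj_eq pI) (negPf ts) mulr0 //.
  move=> /existsPn nS; rewrite mul1r big1 ?subr0 // => s _.
  by rewrite (negPf (nS s)) mulr0.
have preE : pre i m x = paths F L S i m.+1 (x - 1) + paths F L S i m x
  + ((i == m) && (x == L))%:R by [].
rewrite {1}hit {}preE lattice_paths_step.
move: (paths F L S i m.+1 (x - 1)) => b.
under [X in _ - (_ - X) = _]eq_bigr => s _ do rewrite lattice_paths_step !mulrDr.
rewrite !big_split /= xpair_eqE eqSS [L == x]eq_sym andbC.
ring.
Qed.

(** A permutation with a nonzero term never lowers the weight, and its total change of weight is 0;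
    so it preserves all weights and must be the identity. *)
Lemma det_strict_order (F : comNzRingType) (n : nat) (A : 'M[F]_n)
    (wt : 'I_n -> int) :
  (forall i j, A i j != 0 -> i = j \/ wt i < wt j) ->
  \det A = \prod_i A i i.
Proof.
move=> h; rewrite /determinant (bigD1 (1%g : 'S_n)) //= [X in _ + X]big1 ?addr0.
  rewrite odd_perm1 expr0 mul1r.
  by apply: eq_bigr => i _; rewrite perm1.
move=> s s1; have [i Ai|hA] := pickP (fun i => A i (s i) == 0).
  by rewrite (bigD1 i) //= (eqP Ai) mul0r mulr0.
have {}hA i : i = s i \/ wt i < wt (s i) by apply: h; rewrite hA.
have le i : wt i <= wt (s i) by case: (hA i) => [<-|/ltW].
have sums : \sum_i (wt (s i) - wt i) = 0.
  by rewrite sumrB [X in _ - X](reindex_inj (@perm_inj _ s)) /= subrr.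
case/eqP: s1; apply/permP => i; rewrite perm1.
have : wt (s i) - wt i == 0.
  by apply/eqP; apply: (psumr_eq0P _ sums) => // j _; rewrite subr_ge0.
by rewrite subr_eq0; case: (hA i) => // hlt /eqP e; rewrite e ltxx in hlt.
Qed.

(** Abscissa plus level grows strictly along a nontrivial path, so the matrix is unitriangular up to
    reordering. *)
Lemma det_lattice_paths (F : comNzRingType) (k : nat) (p : 'I_k -> int * nat) :
  injective p -> \det (\matrix_(s, t) lattice_paths F (p s) (p t)) = 1.
Proof.
move=> pI; rewrite (@det_strict_order _ _ _ (fun s => (p s).1 + (p s).2%:Z)).
  rewrite big1 // => s _; rewrite mxE /lattice_paths lexx leqnn subrr subnn.
  by rewrite bin0.
move=> s t; rewrite mxE /lattice_paths.
case: ifP => [/andP[h1 h2] _|_]; last by rewrite eqxx.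
have [e|ne] := eqVneq (p s) (p t); first by left; apply: pI.
right; move: h1 h2 ne; case: (p s) => a b; case: (p t) => c d /=.
by rewrite xpair_eqE; lia.
Qed.

(* Both sides are determinants of the block matrix of lattice path counts from
   the points [p s] and the sources to the points [p t] and the top row, reduced
   by block row operations, resp. by block column operations. *)
Lemma size_arrays_ratio (F : comNzRingType) (L : int) (n k : nat) (b : seq int)
    (p : 'I_k -> int * nat) (c : 'I_n -> 'I_k -> F) :
  decreasing n b -> (forall j, (j < n)%N -> L <= nth 0 b j) ->
  injective p -> (forall s, L <= (p s).1) -> (forall s, (0 < (p s).2)%N) ->
  (forall (i : 'I_n) s, lattice_paths F (L, i.+1) (p s) =
     \sum_(j < n) lattice_paths F (L, i.+1) (nth 0 b j, n) * c j s) ->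
  (size (arrays L (occupied p) n b))%:R =
  (size (arrays L (fun _ _ => false) n b))%:R *
  \det (\matrix_(s, t) (lattice_paths F (p s) (p t)
     - \sum_(j < n) lattice_paths F (p s) (nth 0 b j, n) * c j t)).
Proof.
move=> db Lb pI pL p0 hc.
have [g hg] := paths_first_hit F pI pL p0.
(* The unrestricted count is the case of an empty family of forbidden points, where the correction
   sum is empty. *)
pose p1 (s : 'I_0) : int * nat := (0, 0%N).
have [g0 hg0] : exists g : nat -> 'I_0 -> F, forall i m x, L <= x ->
    paths F L (occupied p1) i m x = lattice_paths F (L, i.+1) (x, m)
    - \sum_s g i s * lattice_paths F (p1 s) (x, m).
  by apply: paths_first_hit => -[].
rewrite (size_arrays F _ db Lb).
have -> : (fun _ _ => false) = occupied p1.
  apply/funext => l; apply/funext => x; by apply/esym/existsP; case=> -[].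
rewrite (size_arrays F _ db Lb).
pose PP : 'M[F]_k := \matrix_(s, t) lattice_paths F (p s) (p t).
pose PB : 'M[F]_(k, n) := \matrix_(s, j) lattice_paths F (p s) (nth 0 b j, n).
pose HP : 'M[F]_(n, k) := \matrix_(i, s) lattice_paths F (L, i.+1) (p s).
pose HB : 'M[F]_n := \matrix_(i, j) lattice_paths F (L, i.+1) (nth 0 b j, n).
pose G : 'M[F]_(n, k) := \matrix_(i, s) g i s.
pose C : 'M[F]_(n, k) := \matrix_(j, s) c j s.
have HPE : HP = HB *m C.
  by apply/matrixP => i s; rewrite !mxE hc; apply: eq_bigr => j _; rewrite !mxE.
(* No avoiding path ends at a forbidden point, so the first-hit formula at [p s] reads
   [0 = HP - G *m PP]. *)
have HPG : HP = G *m PP.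
  apply/matrixP => i s; rewrite !mxE.
  have := hg i (p s).2 (p s).1 (pL s).
  have -> : paths F L (occupied p) i (p s).2 (p s).1 = 0.
    have := p0 s; case E : (p s).2 => [//|m] _; rewrite paths_step //.
    have -> : occupied p m.+1 (p s).1.
      by apply/existsP; exists s; rewrite -E -surjective_pairing.
    by rewrite mul0r.
  move/eqP; rewrite eq_sym subr_eq0 -surjective_pairing => /eqP ->.
  by apply: eq_bigr => t _; rewrite !mxE.
set X := \matrix_(i, j) _; set Y := \matrix_(i, j) _; set K := \matrix_(s, t) _.
have XE : X = HB - G *m PB.
  apply/matrixP => i j; rewrite !mxE hg ?Lb //; congr (_ - _).
  by apply: eq_bigr => s _; rewrite !mxE.
have YE : Y = HB.
  by apply/matrixP => i j; rewrite !mxE hg0 ?Lb // big_ord0 subr0.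
have KE : K = PP - PB *m C.
  apply/matrixP => s t; rewrite !mxE; congr (_ - _).
  by apply: eq_bigr => j _; rewrite !mxE.
pose Z := block_mx PP PB HP HB.
(* Subtracting [G] times the upper block row clears [HP] and leaves the avoiding counts; [PP] has
   determinant 1. *)
have Z1 : \det Z = \det X.
  have : block_mx 1%:M 0 (- G) 1%:M *m Z = block_mx PP PB 0 X.
    rewrite mulmx_block !mul1mx !mul0mx !addr0 !mulNmx XE HPG addNr.
    by rewrite addrC.
  move/(congr1 determinant); rewrite det_mulmx det_lblock !det1 !mul1r => ->.
  by rewrite det_ublock det_lattice_paths // mul1r.
(* Since [C] solves the linear system, the column operation also clears [HP], and leaves the
   unrestricted counts beside the matrix over the points. *)
have Z2 : \det Z = \det K * \det Y.
  have : Z *m block_mx 1%:M 0 (- C) 1%:M = block_mx K PB 0 HB.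
    rewrite mulmx_block !mulmx1 !mulmx0 !add0r !mulmxN KE HPE subrr.
    by [].
  move/(congr1 determinant); rewrite det_mulmx det_lblock !det1 !mulr1 => ->.
  by rewrite det_ublock YE.
by rewrite -Z1 Z2 mulrC.
Qed.

(** * Red points as the points off the paths *)

Lemma interlacingP (n : nat) (beta : n.-tuple int) (a : seq (seq int)) :
  interlacing beta a <->
  [/\ shape a = iota 1 n, nth [::] a n.-1 = beta
    & forall l i, (l.+1 < n)%N -> (i <= l)%N ->
        nth 0 (nth [::] a l.+1) i.+1 < nth 0 (nth [::] a l) i
          <= nth 0 (nth [::] a l.+1) i].
Proof.
split=> -[h1 h2 h3]; split=> //.
  by move=> l i ln il; have [-> ->] := h3 l.+1 i.+1 ln il.
move=> [//|l] [//|i] ln il.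
by have /andP[] := h3 l i ln il; split.
Qed.

(** Red means uncovered: beyond the run that ends at the last entry, and in no run between two rows.
    For [l = 0] there are no runs of the second kind, so the default [l.-1 = 0] is harmless. *)
Lemma redP (n l : nat) (a : seq (seq int)) (x : int) :
  (forall l i, (l.+1 < n)%N -> (i <= l)%N ->
     nth 0 (nth [::] a l.+1) i.+1 < nth 0 (nth [::] a l) i
       <= nth 0 (nth [::] a l.+1) i) ->
  (l < n)%N ->
  red a (x, l.+1) <->
  nth 0 (nth [::] a l) l < x /\
  forall i, (i < l)%N ->
    ~~ (nth 0 (nth [::] a l.-1) i <= x <= nth 0 (nth [::] a l) i).
Proof.
move=> h ln; set y := nth [::] a l; set z := nth [::] a l.-1.
have hz i : (i < l)%N -> nth 0 y i.+1 < nth 0 z i <= nth 0 y i.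
  rewrite /y /z; case: l ln {y z} => [//|l] ln il; exact: h.
have ydec i j : (i <= j)%N -> (j <= l)%N -> nth 0 y j <= nth 0 y i.
  elim: j => [|j IH]; first by rewrite leqn0 => /eqP ->.
  rewrite leq_eqVlt => /orP[/eqP -> //|ij] jl.
  apply: le_trans (IH ij (ltnW jl)).
  by have /andP[h1 h2] := hz _ jl; apply: le_trans h2; apply: ltW.
split.
  case=> -[|i] [] //= il yx; rewrite /entry /= -/y -/z => xz.
  split; first by apply: le_lt_trans yx; apply: ydec.
  move=> j jl; apply/negP => /andP[zx xy].
  have ji : (j < i)%N.
    rewrite ltnNge; apply/negP => ij.
    have := lt_le_trans yx xy; rewrite ltNge.
    by rewrite (ydec i j ij (ltnW jl)).
  case: xz => [[i0]|]; first by rewrite i0 in ji.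
  case: i il yx ji => [//|i] il yx ji xz.
  have zz : nth 0 z i <= nth 0 z j.
    move: ji; rewrite ltnS leq_eqVlt => /orP[/eqP -> //|ji].
    have /andP[_ h1] := hz i il; have /andP[h2 _] := hz j jl.
    apply: le_trans h1 (le_trans _ (ltW h2)).
    by apply: ydec => //; apply: ltnW.
  by have := lt_le_trans xz (le_trans zz zx); rewrite ltxx.
case=> yx hx.
(* The first entry left of [x]: the preceding entry is at least [x], so an uncovered [x] lies left
   of the entry of the lower row between them. *)
case: (@ex_minnP (fun i => nth 0 y i < x) (ex_intro _ l yx)) => i yi imin.
have il := imin l yx.
exists i.+1; split=> //; rewrite /entry /= -/y -/z.
case: i yi imin il => [|i] yi imin il; [by left|right].
rewrite ltNge; apply/negP => zx; have := hx i il; rewrite zx /= leNgt.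
case: (boolP (_ < _)) => // /imin; by rewrite ltnn.
Qed.

Lemma card_fset_set_seq (T : choiceType) (s : seq T) : uniq s ->
  #|` fset_set [set x | x \in s] | = size s.
Proof.
move=> us; rewrite -(undup_id us) -card_fseq undup_id //; congr (#|` _|).
apply/fsetP => x; rewrite in_fset_set; last exact: finite_seq.
by rewrite in_fset mem_setE.
Qed.

Lemma interlacing_red_arrays (n : nat) (beta : n.-tuple int) (L : int) (k : nat)
    (p : 'I_k -> int * nat) : (0 < n)%N ->
  (forall s, L <= (p s).1) -> (forall s, (0 < (p s).2 <= n)%N) ->
  interlacing beta `&` [set a | forall s, red a (p s)] =
  [set a | a \in arrays L (occupied p) n beta].
Proof.
move=> n0 pL pn; apply/seteqP; split => a /=.
  case=> /interlacingP [sh ha hi] hr.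
  have sa : size a = n by rewrite -(size_map size a) -/(shape a) sh size_iota.
  apply/mem_arrays; first exact: size_tuple.
  split=> //.
  - by rewrite -nth_last sa.
  - move=> l ln; apply/clear_ofP => x /andP[_ xy].
    apply/negP => /existsP[s /eqP ps]; have := hr s; rewrite ps.
    by move=> /(redP x hi ln)[]; rewrite ltNge xy.
  - move=> l i ln il; apply/clear_ofP => x xy.
    apply/negP => /existsP[s /eqP ps]; have := hr s; rewrite ps.
    by move=> /(redP x hi ln)[_ /(_ i il)] /=; rewrite xy.
move/mem_arrays; rewrite size_tuple => /(_ erefl) [sh ha hi h1 h2].
have sa : size a = n by rewrite -(size_map size a) -/(shape a) sh size_iota.
split.
  by apply/interlacingP; split=> //; rewrite -[in nth _ _ _]sa nth_last.
move=> s; have := pn s; have := pL s.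
case E : (p s) => [x [//|l]] /= Lx ln.
have Sx : occupied p l.+1 x by apply/existsP; exists s; rewrite E.
apply/(redP x hi ln); split.
  rewrite ltNge; apply/negP => xy.
  by have /clear_ofP/(_ x) := h1 l ln; rewrite Lx xy Sx => /(_ isT).
move=> i il; apply/negP => xy; case: l ln il xy Sx {E} => [//|l] ln il xy Sx.
by have /clear_ofP/(_ x xy) := h2 l i ln il; rewrite Sx.
Qed.

Lemma uniform_prob_red (R : realType) (n : nat) (beta : n.-tuple int) (L : int)
    (k : nat) (p : 'I_k -> int * nat) : (0 < n)%N ->
  (forall s, L <= (p s).1) -> (forall s, (0 < (p s).2 <= n)%N) ->
  uniform_prob R (interlacing beta) [set a | forall s, red a (p s)] =
  (size (arrays L (occupied p) n beta))%:R /
  (size (arrays L (fun _ _ => false) n beta))%:R.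
Proof.
move=> n0 pL pn; rewrite /uniform_prob (interlacing_red_arrays _ n0 pL pn).
rewrite card_fset_set_seq ?arrays_uniq ?size_tuple //; congr (_ / _).
(* With no points prescribed the event is everything, which makes the denominator a count of the
   same kind. *)
pose q (s : 'I_0) : int * nat := (0, 0%N).
have -> : (fun _ _ => false) = occupied q.
  by apply/funext => l; apply/funext => x; apply/esym/existsP; case=> -[].
rewrite -[interlacing beta]setIT.
have -> : setT = [set a | forall s, red a (q s)].
  by apply/esym/seteqP; split=> // a _ [].
rewrite (@interlacing_red_arrays _ beta L) //; try by case.
by rewrite card_fset_set_seq ?arrays_uniq ?size_tuple.
Qed.

(** * The kernel as a sum of residues *)

Lemma prod_zrange_rising (A : comNzRingType) (z : A) (x : int) (s : nat) :
  \prod_(k <- zrange (x + 1 - s%:Z) x) (z - k%:~R) = rising (z - x%:~R) s.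
Proof.
have -> : zrange (x + 1 - s%:Z) x = [seq x + 1 - s%:Z + i%:Z | i <- index_iota 0 s].
  by rewrite /index_iota subn0 -zrangeE; congr zrange; lia.
rewrite big_map big_mkord (reindex_inj rev_ord_inj) /=.
apply: eq_bigr => i _.
have -> : x + 1 - s%:Z + (s - i.+1)%N%:Z = x - i%:Z by have := ltn_ord i; lia.
by rewrite rmorphB /= opprB addrCA addrC.
Qed.

Lemma rising_natD1 (A : comNzRingType) (d s : nat) :
  rising (d%:R + 1) s = ('C(d + s, s) * s`!)%:R :> A.
Proof.
elim: s => [|s IH]; first by rewrite /rising big_ord0 bin0.
rewrite risingS IH addnS factS.
have -> : ('C((d + s).+1, s.+1) * (s.+1 * s`!) =
    (d + s).+1 * ('C(d + s, s) * s`!))%N.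
  by rewrite mulnCA mulnA -mul_bin_diag mulnA.
by rewrite [in RHS]natrM mulrC -natr1 natrD addrAC.
Qed.

(** With the number of up steps fixed, the binomial is a polynomial in [b], which opens the way to
    residues. The indicator has to stay, as this polynomial is nonzero for [b] far to the left of
    [x]. *)
Lemma lattice_paths_top (F : numFieldType) (x b : int) (y n : nat) : (y <= n)%N ->
  lattice_paths F (x, y) (b, n) * (n - y)`!%:R =
  (x <= b)%R%:R * rising (b%:~R - x%:~R + 1) (n - y).
Proof.
move=> yn; rewrite /lattice_paths /= yn andbT.
case: ifP => xb; last by rewrite !mul0r.
have [d ->] : exists d : nat, b = x + d%:Z by exists `|(b - x)%R|%N; lia.
have -> : `|(x + d%:Z - x)%R|%N = d by lia.
by rewrite mul1r -natrM -rising_natD1 rmorphD /= [x%:~R + _]addrC addrK -pmulrn.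
Qed.

(** Euclidean quotient: the denominator of the w-integrand need not divide [B], and the remainder
    drops out when all residues in [w] are summed. *)
Definition kernel_quotient (F : fieldType) (beta : seq int) (p : int * nat) :
    {poly F} :=
  \prod_(b <- beta) ('X - (b%:~R)%:P) %/
  \prod_(k <- zrange (p.1 + p.2%:Z - (size beta)%:Z) p.1) ('X - (k%:~R)%:P).

(* The residue at [z = b] of what is left after the [w]-integration. *)
Definition kernel_residue (F : fieldType) (beta : seq int) (p1 p2 : int * nat)
    (b : int) : F :=
  (\prod_(k <- zrange (p2.1 + p2.2%:Z - (size beta)%:Z) (p2.1 - 1))
     (b%:~R - k%:~R))
  * (kernel_quotient F beta p1).[b%:~R]
  / \prod_(v <- beta | v != b) (b%:~R - v%:~R).

Lemma kernel_residueE (F : fieldType) (beta : seq int) (p1 p2 : int * nat)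
    (b : int) : (p1.2 <= size beta)%N -> (p2.2 <= size beta)%N ->
  kernel_residue F beta p1 p2 b =
  rising (b%:~R - p2.1%:~R + 1) (size beta - p2.2)
  * (\prod_(b <- beta) ('X - (b%:~R)%:P) %/
     rising ('X - (p1.1%:~R)%:P) (size beta - p1.2).+1).[b%:~R]
  / \prod_(v <- beta | v != b) (b%:~R - v%:~R).
Proof.
move=> y1 y2; rewrite /kernel_residue; congr (_ * _ / _).
  have -> : p2.1 + p2.2%:Z - (size beta)%:Z =
    (p2.1 - 1) + 1 - (size beta - p2.2)%N%:Z by lia.
  by rewrite prod_zrange_rising rmorphB /= opprB addrCA addrC.
rewrite /kernel_quotient.
have -> : p1.1 + p1.2%:Z - (size beta)%:Z =
  p1.1 + 1 - (size beta - p1.2).+1%N%:Z by lia.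
have PC (k : int) : (k%:~R)%:P = k%:~R :> {poly F} by exact: (rmorph_int polyC).
rewrite [in RHS]PC -prod_zrange_rising; congr ((_ %/ _).[_]).
by apply: eq_bigr => k _; rewrite PC.
Qed.

(** With [r = n - y1], [s = n - y2] and [d = x1 - x2], duality gives [C(s, r)] times the rising
    factorial of [d + 1] of length [s - r = y1 - y2], which is a path count up to factorials. For
    [y2 > y1] both [C(s, r)] and the path count are 0. *)
Lemma sum_kernel_residue (F : numFieldType) (beta : seq int) (p1 p2 : int * nat) :
  uniq beta -> p2.1 <= p1.1 ->
  (0 < p1.2 <= size beta)%N -> (0 < p2.2 <= size beta)%N ->
  \sum_(b <- beta) kernel_residue F beta p1 p2 b =
  (size beta - p2.2)`!%:R / (size beta - p1.2)`!%:R * lattice_paths F p2 p1.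
Proof.
set n := size beta => ub x21 /andP[y10 y1n] /andP[y20 y2n].
under eq_bigr => b _ do rewrite kernel_residueE //.
set r := (n - p1.2)%N; set s := (n - p2.2)%N.
pose bF := [seq b%:~R : F | b <- beta].
have uF : uniq bF by rewrite map_inj_uniq //; exact: intr_inj.
have sF : size bF = n by rewrite size_map.
have rn : (r < size bF)%N by rewrite sF /r; lia.
have sn : (s < size bF)%N by rewrite sF /s; lia.
have := residues_shifted_rising (p1.1%:~R) (p2.1%:~R) uF rn sn.
have dE b : \prod_(v <- bF | v != b%:~R) (b%:~R - v) =
    \prod_(v <- beta | v != b) (b%:~R - v%:~R).
  by rewrite big_map; apply: eq_bigl => v; rewrite (inj_eq intr_inj).
rewrite /= 2!big_map.
under eq_bigr => b _ do rewrite dE.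
move=> ->.
have [d xE] : exists d : nat, p1.1 = p2.1 + d%:Z.
  by move: x21; move: p1.1 p2.1 => u v uv; exists (`|(u - v)%R|%N); lia.
rewrite /lattice_paths x21 /= xE rmorphD /= [p2.1%:~R + _]addrC addrK -pmulrn.
rewrite rising_natD1.
have -> : `|(p2.1 + d%:Z - p2.1)%R|%N = d by rewrite addrC addKr.
case: (leqP p2.2 p1.2) => y21; last first.
  by rewrite mulr0 (@bin_small s r) ?mulr0n // ltn_sub2l // (leq_trans y21).
have -> : (p1.2 - p2.2)%N = (s - r)%N by rewrite /r /s; lia.
have rs : (r <= s)%N by rewrite leq_sub2l.
have r0 : (r`!%:R : F) != 0 by rewrite pnatr_eq0 -lt0n fact_gt0.
apply: (mulIf r0); rewrite [RHS]mulrAC divfK // -[_ *+ 'C(s, r)]mulr_natr -!natrM -(bin_fact rs).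
by congr _%:R; ring.
Qed.

Definition residue_kernel (F : fieldType) (beta : seq int) (p1 p2 : int * nat) : F :=
  - ((p1.1 < p2.1)%R%:R
     * \sum_(b <- beta | p2.1 <= b) kernel_residue F beta p1 p2 b)
  + (p2.1 <= p1.1)%R%:R
     * \sum_(b <- beta | b < p2.1) kernel_residue F beta p1 p2 b.

(** Merges the two indicators: for [x1 < x2] no path leads from [p2] to [p1], and for [x1 >= x2] the
    sum over [b < x2] is the full sum minus the one over [b >= x2]. The result has the shape
    [phi - sum_j phi c_j]. *)
Lemma residue_kernelE (F : numFieldType) (beta : seq int) (p1 p2 : int * nat) :
  uniq beta -> (0 < p1.2 <= size beta)%N -> (0 < p2.2 <= size beta)%N ->
  residue_kernel F beta p1 p2 =
  (size beta - p2.2)`!%:R / (size beta - p1.2)`!%:R * lattice_paths F p2 p1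
  - \sum_(b <- beta | p2.1 <= b) kernel_residue F beta p1 p2 b.
Proof.
move=> ub y1 y2; rewrite /residue_kernel.
have [x12|x21] := ltP p1.1 p2.1.
  by rewrite mul1r mul0r addr0 /lattice_paths leNgt x12 /= mulr0 sub0r.
rewrite mul0r oppr0 add0r mul1r -sum_kernel_residue //.
rewrite [X in _ = X - _](bigID (fun b => p2.1 <= b)) /= addrAC subrr add0r.
by apply: eq_bigl => b; rewrite ltNge.
Qed.

(** Dropping the smallest entry of each row gives an array, because the weak inequality
    [y^(m)_i <= y^(m+1)_i] allows equality. *)
Lemma arrays_nonempty (L : int) (m : nat) (y : seq int) : decreasing m y ->
  (0 < size (arrays L (fun _ _ => false) m y))%N.
Proof.
have cl a b : clear_of (fun _ => false) a b by apply/clear_ofP.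
elim: m y => [//|m IH] y dy; have [sy hy] := dy.
rewrite -has_predT /= cl; apply/hasP.
have sz : size (take m y) = m by rewrite size_take sy ltnSn.
have tb : take m y \in below (fun _ => false) y.
  apply/(mem_below _ _ sy); split=> // j jm; rewrite nth_take // lexx andbT.
  by split; [apply: hy | exact: cl].
have /IH := decreasing_below dy tb; rewrite -has_predT => /hasP[a az _].
by exists (rcons a y) => //; apply/allpairsPdep; exists (take m y), a.
Qed.

(** Absorbs the two ways in which the kernel differs from the matrix of path counts: exchanged
    arguments, and a ratio of factorials [(n - y_j)! / (n - y_i)!]. *)
Lemma det_conj_diag (F : fieldType) (k : nat) (w : 'I_k -> F) (A B : 'M[F]_k) :
  (forall i, w i != 0) -> (forall i j, B i j = w j / w i * A j i) ->
  \det B = \det A.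
Proof.
move=> w0 BE.
pose V := diag_mx (\row_i (w i)^-1); pose W := diag_mx (\row_i w i).
have -> : B = V *m A^T *m W.
  apply/matrixP => i j; rewrite BE mul_mx_diag mxE mul_diag_mx !mxE; ring.
have VW : \det V * \det W = 1.
  rewrite !det_diag -big_split /= big1 // => i _.
  by rewrite !mxE mulVf.
by rewrite !det_mulmx det_tr mulrAC VW mul1r.
Qed.

Lemma size_arrays_kernel (F : numFieldType) (L : int) (beta : seq int) (k : nat)
    (p : 'I_k -> int * nat) :
  decreasing (size beta) beta ->
  (forall j, (j < size beta)%N -> L <= nth 0 beta j) ->
  injective p -> (forall s, L <= (p s).1) ->
  (forall s, (0 < (p s).2 <= size beta)%N) ->
  (size (arrays L (occupied p) (size beta) beta))%:R /
  (size (arrays L (fun _ _ => false) (size beta) beta))%:R =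
  \det (\matrix_(i < k, j < k) residue_kernel F beta (p i) (p j)).
Proof.
set n := size beta => db Lb pI pL pn.
have ub : uniq beta.
  apply/(uniqP 0) => i j; rewrite !inE => ib jb e.
  case: (ltngtP i j) => // ij.
    by have := decreasing_lt db ij jb; rewrite e ltxx.
  by have := decreasing_lt db ij ib; rewrite e ltxx.
have fact0 y : ((n - y)`!%:R : F) != 0 by rewrite pnatr_eq0 -lt0n fact_gt0.
(* The factorial cancels the denominator in [sum_kernel_residue], so that [c] solves the system with
   no extra constant. *)
pose c (j : 'I_n) (s : 'I_k) : F := (n - (p s).2)`!%:R *
  (kernel_quotient F beta (p s)).[(nth 0 beta j)%:~R]
  / \prod_(v <- beta | v != nth 0 beta j) ((nth 0 beta j)%:~R - v%:~R).
have cE q (j : 'I_n) s : (0 < q.2 <= n)%N ->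
    lattice_paths F q (nth 0 beta j, n) * c j s =
    (n - (p s).2)`!%:R / (n - q.2)`!%:R * ((q.1 <= nth 0 beta j)%R%:R *
      kernel_residue F beta (p s) q (nth 0 beta j)).
  move=> /andP[q0 qn]; apply: (mulIf (fact0 q.2)).
  rewrite mulrAC [q]surjective_pairing lattice_paths_top //= -surjective_pairing.
  rewrite [in RHS]mulrAC divfK // /kernel_residue /c.
  have -> : q.1 + q.2%:Z - (size beta)%:Z =
    (q.1 - 1) + 1 - (n - q.2)%N%:Z by rewrite /n in qn *; lia.
  rewrite prod_zrange_rising rmorphB /= opprB.
  rewrite [_ + (1 - _)]addrA [_ + 1 - _]addrAC; ring.
have sumE q s : (0 < q.2 <= n)%N ->
    \sum_(j < n) lattice_paths F q (nth 0 beta j, n) * c j s =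
    (n - (p s).2)`!%:R / (n - q.2)`!%:R *
      \sum_(b <- beta | q.1 <= b) kernel_residue F beta (p s) q b.
  move=> qn; under eq_bigr => j _ do rewrite cE //.
  rewrite -mulr_sumr [in RHS]big_mkcond (big_nth 0) big_mkord /=.
  congr (_ * _); apply: eq_bigr => j _.
  by case: ifP; rewrite ?mul1r ?mul0r.
(* Every entry of [beta] is at least [L], so the restricted sum is the full residue sum, which is
   the path count. *)
have hc (i : 'I_n) s : lattice_paths F (L, i.+1) (p s) =
    \sum_(j < n) lattice_paths F (L, i.+1) (nth 0 beta j, n) * c j s.
  rewrite sumE //=.
  have -> : \sum_(b <- beta | L <= b) kernel_residue F beta (p s) (L, i.+1) b =
      \sum_(b <- beta) kernel_residue F beta (p s) (L, i.+1) b.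
    rewrite big_mkcond big_seq [RHS]big_seq; apply: eq_bigr => b /(nthP 0)[j jb <-].
    by rewrite Lb.
  rewrite sum_kernel_residue //= ?pn // -/n.
  by rewrite !mulrA divfK // mulfV // mul1r.
have p0 s : (0 < (p s).2)%N by case/andP: (pn s).
rewrite (size_arrays_ratio db Lb pI pL p0 hc) mulrAC divff ?mul1r; last first.
  by rewrite pnatr_eq0 -lt0n arrays_nonempty.
apply/esym/(@det_conj_diag _ _ (fun i => (n - (p i).2)`!%:R)) => // i j.
rewrite !mxE residue_kernelE // sumE // mulrBr; congr (_ - _).
by rewrite !mulrA divfK // mulfV // mul1r.
Qed.

(** * Contour integrals *)

Notation real_integrable D f :=
  ((@lebesgue_measure _).-integrable D (EFin \o f)).

(** Finite sets are null, so break points and exceptional times of a curve may be ignored. Points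
    are removed one at a time; [f] stays measurable because any function is measurable on a
    singleton. *)
Lemma Rintegral_eq_off_seq (R : realType) (D : set R) (s : seq R) (f h : R -> R) :
  measurable D -> real_integrable D h ->
  (forall t, D t -> t \notin s -> f t = h t) ->
  real_integrable D f /\
  Rintegral lebesgue_measure D f = Rintegral lebesgue_measure D h.
Proof.
elim: s D => [|r s IH] D mD ih fh.
  have e : {in D, f =1 h} by move=> t /set_mem Dt; apply: fh.
  split; last exact: eq_Rintegral.
  by apply: eq_integrable ih => // t Dt /=; rewrite e.
have mD' : measurable (D `\ r) by apply: measurableD.
have ih' : real_integrable (D `\ r) h by apply: integrableS ih.
have [if' fh'] : real_integrable (D `\ r) f /\
    Rintegral lebesgue_measure (D `\ r) f = Rintegral lebesgue_measure (D `\ r) h.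
  apply: IH => // t [Dt tr] ts; apply: fh => //.
  by rewrite inE negb_or ts andbT; apply/eqP.
have mf : measurable_fun D f.
  have [Dr|Dr] := pselect (D r).
    rewrite -(setD1K Dr); apply/measurable_funU => //; split.
      exact: measurable_fun_set1.
    apply/measurable_EFinP; exact: measurable_int if'.
  by rewrite -(not_setD1 Dr); apply/measurable_EFinP; exact: measurable_int if'.
move/measurable_EFinP in mf.
split.
  have := @negligible_integrable _ _ _ (@lebesgue_measure R) D [set r] (EFin \o f).
  by case=> //; [exact: lebesgue_measure_set1 | move=> _; exact].
move: fh'; rewrite /Rintegral !integral_setD1 //; first exact: measurable_int ih'.
exact: measurable_int if'.
Qed.

Lemma C1_continuous (R : realType) (f : R -> R) : C1_fun f -> continuous f.
Proof.
by move=> [df _] x; apply: differentiable_continuous; exact/derivable1_diffP.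
Qed.

Lemma derive1_mul (R : realType) (f h : R -> R) (t : R) :
  derivable f t 1 -> derivable h t 1 ->
  derive1 (fun u => f u * h u) t = f t * derive1 h t + h t * derive1 f t.
Proof. by move=> df dh; rewrite !derive1E deriveM. Qed.

Lemma derive1_add (R : realType) (f h : R -> R) (t : R) :
  derivable f t 1 -> derivable h t 1 ->
  derive1 (fun u => f u + h u) t = derive1 f t + derive1 h t.
Proof. by move=> df dh; rewrite !derive1E deriveD. Qed.

Lemma derive1_sub (R : realType) (f h : R -> R) (t : R) :
  derivable f t 1 -> derivable h t 1 ->
  derive1 (fun u => f u - h u) t = derive1 f t - derive1 h t.
Proof. by move=> df dh; rewrite !derive1E deriveB. Qed.

Lemma C1_mul (R : realType) (f h : R -> R) :
  C1_fun f -> C1_fun h -> C1_fun (fun t => f t * h t).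
Proof.
move=> Cf Ch; have [df cf] := Cf; have [dh ch] := Ch.
split=> [t|]; first exact: derivableM.
rewrite (_ : derive1 _ = fun t => f t * derive1 h t + h t * derive1 f t).
  by move=> t; apply: cvgD; apply: cvgM;
    [exact: C1_continuous|exact: ch|exact: C1_continuous|exact: cf].
by apply/funext => t; rewrite derive1_mul.
Qed.

Lemma C1_add (R : realType) (f h : R -> R) :
  C1_fun f -> C1_fun h -> C1_fun (fun t => f t + h t).
Proof.
move=> [df cf] [dh ch].
split=> [t|]; first exact: derivableD.
rewrite (_ : derive1 _ = fun t => derive1 f t + derive1 h t).
  by move=> t; apply: cvgD; [exact: cf|exact: ch].
by apply/funext => t; rewrite derive1_add.
Qed.

Lemma C1_sub (R : realType) (f h : R -> R) :
  C1_fun f -> C1_fun h -> C1_fun (fun t => f t - h t).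
Proof.
move=> [df cf] [dh ch].
split=> [t|]; first exact: derivableB.
rewrite (_ : derive1 _ = fun t => derive1 f t - derive1 h t).
  by move=> t; apply: cvgB; [exact: cf|exact: ch].
by apply/funext => t; rewrite derive1_sub.
Qed.

Lemma C1_cst (R : realType) (a : R) : C1_fun (fun _ => a).
Proof.
split=> [t|]; first exact: derivable_cst.
rewrite (_ : derive1 _ = fun _ => 0); first by move=> t; exact: cvg_cst.
by apply/funext => t; rewrite derive1_cst.
Qed.

Lemma continuous_real_integrable (R : realType) (a b : R) (f : R -> R) :
  (forall x, a <= x <= b -> f y @[y --> within `[a, b] (nbhs x)] --> f x) ->
  real_integrable `[a, b] f.
Proof.
move=> cf; apply: continuous_compact_integrable; first exact: segment_compact.
by apply/subspace_continuousP => x /=; rewrite in_itv; exact: cf.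
Qed.

Lemma Rintegral_derive1 (R : realType) (a b : R) (f : R -> R) :
  a < b -> C1_fun f ->
  Rintegral lebesgue_measure `[a, b] (derive1 f) = f b - f a.
Proof.
move=> ab Cf; have [df cf] := Cf.
rewrite /Rintegral (@continuous_FTC2 _ _ f) //.
- by apply: continuous_subspaceT => x; exact: cf.
- split=> [x _| |]; first exact: df.
    by apply: cvg_at_right_filter; exact: C1_continuous.
  by apply: cvg_at_left_filter; exact: C1_continuous.
Qed.

Lemma Rintegral_concat (R : realType) (a b c : R) (f : R -> R) : a < b -> b < c ->
  real_integrable `[a, b] f -> real_integrable `[b, c] f ->
  real_integrable `[a, c] f /\
  Rintegral lebesgue_measure `[a, c] f =
  Rintegral lebesgue_measure `[a, b] f + Rintegral lebesgue_measure `[b, c] f.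
Proof.
move=> ab bc i1 i2.
have E : `[a, c]%classic = `[a, b]%classic `|` `]b, c]%classic.
  by rewrite -itv_bndbnd_setU // bnd_simp ?ltW.
have i2' : real_integrable `]b, c] f.
  by apply: integrableS i2 => //; apply: subset_itvr; rewrite bnd_simp.
have dis : [disjoint `[a, b]%classic & `]b, c]%classic].
  apply/disj_setPS => x /= []; rewrite !in_itv /= => /andP[_ xb] /andP[bx _].
  by have := lt_le_trans bx xb; rewrite ltxx.
have i3 : real_integrable (`[a, b]%classic `|` `]b, c]%classic) f.
  have /integrableP[m1 f1] := i1; have /integrableP[m2 f2] := i2'.
  have m3 : measurable_fun (`[a, b]%classic `|` `]b, c]%classic) f.
    by apply/measurable_funU => //; split; exact/measurable_EFinP.
  move/measurable_EFinP in m3.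
  apply/integrableP; split=> //.
  rewrite ge0_integral_setU //; first exact: lte_add_pinfty.
  by apply: measurableT_comp.
rewrite E; split=> //; rewrite Rintegral_setU //.
by rewrite Rintegral_itv_obnd_cbnd.
Qed.

Lemma real_integrableD (R : realType) (D : set R) (f h : R -> R) : measurable D ->
  real_integrable D f -> real_integrable D h ->
  real_integrable D (fun t => f t + h t).
Proof.
move=> mD jf jh; have := @integrableD _ _ _ (@lebesgue_measure R) D mD _ _ jf jh.
by apply: eq_integrable => // t _ /=; rewrite EFinD.
Qed.

Lemma real_integrableZ (R : realType) (D : set R) (k : R) (f : R -> R) :
  measurable D -> real_integrable D f -> real_integrable D (fun t => k * f t).
Proof.
move=> mD jf; have := @integrableZl _ _ _ (@lebesgue_measure R) D mD k _ jf.
by apply: eq_integrable => // t _ /=; rewrite EFinM.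
Qed.

(** * Complex-valued functions on an interval, through real and imaginary parts *)

Lemma ReM (R : realType) (x y : R[i]) :
  complex.Re (x * y) = complex.Re x * complex.Re y - complex.Im x * complex.Im y.
Proof. by case: x y => [a b] [c d]. Qed.

Lemma ImM (R : realType) (x y : R[i]) :
  complex.Im (x * y) = complex.Re x * complex.Im y + complex.Im x * complex.Re y.
Proof. by case: x y => [a b] [c d]. Qed.

Lemma ReD (R : realType) (x y : R[i]) :
  complex.Re (x + y) = complex.Re x + complex.Re y.
Proof. by case: x y => [a b] [c d]. Qed.

Lemma ImD (R : realType) (x y : R[i]) :
  complex.Im (x + y) = complex.Im x + complex.Im y.
Proof. by case: x y => [a b] [c d]. Qed.

Lemma ReV (R : realType) (x : R[i]) :
  complex.Re x^-1 = complex.Re x / (complex.Re x ^+ 2 + complex.Im x ^+ 2).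
Proof. by case: x. Qed.

Lemma ImV (R : realType) (x : R[i]) :
  complex.Im x^-1 = - (complex.Im x / (complex.Re x ^+ 2 + complex.Im x ^+ 2)).
Proof. by case: x. Qed.

Lemma complex_ext (R : realType) (x y : R[i]) :
  complex.Re x = complex.Re y -> complex.Im x = complex.Im y -> x = y.
Proof. by case: x y => [a b] [c d] /= -> ->. Qed.

Definition cC1 (R : realType) (h : R -> R[i]) : Prop :=
  C1_fun (fun t => complex.Re (h t)) /\ C1_fun (fun t => complex.Im (h t)).

Lemma cC1_mul (R : realType) (u v : R -> R[i]) :
  cC1 u -> cC1 v -> cC1 (fun t => u t * v t).
Proof.
move=> [ur ui] [vr vi]; split.
  rewrite (_ : (fun t => _) = fun t => complex.Re (u t) * complex.Re (v t)
    - complex.Im (u t) * complex.Im (v t)).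
    by apply: C1_sub; apply: C1_mul.
  by apply/funext => t; rewrite ReM.
rewrite (_ : (fun t => _) = fun t => complex.Re (u t) * complex.Im (v t)
  + complex.Im (u t) * complex.Re (v t)).
  by apply: C1_add; apply: C1_mul.
by apply/funext => t; rewrite ImM.
Qed.

Lemma cC1_sub_cst (R : realType) (u : R -> R[i]) (a : R[i]) :
  cC1 u -> cC1 (fun t => u t - a).
Proof.
move=> [ur ui]; split.
  rewrite (_ : (fun t => _) = fun t => complex.Re (u t) - complex.Re a).
    by apply: C1_sub => //; apply: C1_cst.
  by apply/funext => t; case: (u t) a => [? ?] [].
rewrite (_ : (fun t => _) = fun t => complex.Im (u t) - complex.Im a).
  by apply: C1_sub => //; apply: C1_cst.
by apply/funext => t; case: (u t) a => [? ?] [].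
Qed.

Lemma cderive_mul (R : realType) (u v : R -> R[i]) (t : R) : cC1 u -> cC1 v ->
  cderive (fun s => u s * v s) t = u t * cderive v t + v t * cderive u t.
Proof.
move=> [ur ui] [vr vi].
have dur := ur.1; have dui := ui.1; have dvr := vr.1; have dvi := vi.1.
apply: complex_ext; rewrite /cderive /=.
  rewrite (_ : (fun t => _) = fun t => complex.Re (u t) * complex.Re (v t)
    - complex.Im (u t) * complex.Im (v t)); last by apply/funext => s; rewrite ReM.
  rewrite derive1_sub ?derive1_mul //; try exact: derivableM.
  by rewrite ReD !ReM /=; ring.
rewrite (_ : (fun t => _) = fun t => complex.Re (u t) * complex.Im (v t)
  + complex.Im (u t) * complex.Re (v t)); last by apply/funext => s; rewrite ImM.
rewrite derive1_add ?derive1_mul //; try exact: derivableM.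
by rewrite ImD !ImM /=; ring.
Qed.

Lemma cC1_pow (R : realType) (h : R -> R[i]) (k : nat) :
  cC1 h -> cC1 (fun t => h t ^+ k).
Proof.
move=> Ch; elim: k => [|k IH]; first by split; apply: C1_cst.
rewrite (_ : (fun t => _) = fun t => h t * h t ^+ k); first exact: cC1_mul.
by apply/funext => t; rewrite exprS.
Qed.

Lemma cderive_pow (R : realType) (h : R -> R[i]) (k : nat) (t : R) : cC1 h ->
  cderive (fun s => h s ^+ k.+1) t = k.+1%:R * (h t ^+ k * cderive h t).
Proof.
move=> Ch; elim: k => [|k IH].
  by rewrite mul1r expr0 mul1r; congr cderive; apply/funext => s; rewrite expr1.
rewrite (_ : (fun s => _) = fun s => h s * h s ^+ k.+1); last first.
  by apply/funext => s; rewrite exprS.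
by rewrite (cderive_mul t Ch (cC1_pow k.+1 Ch)) IH -[k.+2%:R]natr1 exprS; ring.
Qed.

(** Continuity relative to [[a, b]], since reciprocals along a piece of a curve are known to have no
    pole only there. *)
Definition ccontinuous (R : realType) (a b : R) (u : R -> R[i]) : Prop :=
  forall x, a <= x <= b ->
    (complex.Re (u y) @[y --> within `[a, b] (nbhs x)] --> complex.Re (u x)) /\
    (complex.Im (u y) @[y --> within `[a, b] (nbhs x)] --> complex.Im (u x)).

Lemma cC1_ccontinuous (R : realType) (a b : R) (h : R -> R[i]) :
  cC1 h -> ccontinuous a b h /\ ccontinuous a b (cderive h).
Proof.
move=> [hr hi]; split=> x _; split; apply: cvg_within_filter.
- exact: (C1_continuous hr).
- exact: (C1_continuous hi).
- exact: hr.2.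
- exact: hi.2.
Qed.

Lemma ccontinuous_mul (R : realType) (a b : R) (u v : R -> R[i]) :
  ccontinuous a b u -> ccontinuous a b v -> ccontinuous a b (fun t => u t * v t).
Proof.
move=> cu cv x xab; have [ur ui] := cu x xab; have [vr vi] := cv x xab; split.
  rewrite (_ : (fun y => _) = fun t => complex.Re (u t) * complex.Re (v t)
    - complex.Im (u t) * complex.Im (v t)); last by apply/funext => s; rewrite ReM.
  by rewrite ReM; apply: cvgB; apply: cvgM.
rewrite (_ : (fun y => _) = fun t => complex.Re (u t) * complex.Im (v t)
  + complex.Im (u t) * complex.Re (v t)); last by apply/funext => s; rewrite ImM.
by rewrite ImM; apply: cvgD; apply: cvgM.
Qed.

Lemma ccontinuous_inv (R : realType) (a b : R) (u : R -> R[i]) :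
  (forall x, a <= x <= b -> u x != 0) ->
  ccontinuous a b u -> ccontinuous a b (fun t => (u t)^-1).
Proof.
move=> u0 cu x xab; have [ur ui] := cu x xab; have := u0 x xab.
set n := complex.Re (u x) ^+ 2 + complex.Im (u x) ^+ 2 => ux.
have n0 : n != 0.
  apply: contra ux; rewrite /n paddr_eq0 ?sqr_ge0 // !sqrf_eq0 => /andP[/eqP e1 /eqP e2].
  by apply/eqP; apply: complex_ext.
have cn : (complex.Re (u y) ^+ 2 + complex.Im (u y) ^+ 2)^-1
    @[y --> within `[a, b] (nbhs x)] --> n^-1.
  by apply: cvgV => //; apply: cvgD; rewrite expr2; apply: cvgM.
split.
  rewrite (_ : (fun y => _) = fun t => complex.Re (u t)
    * (complex.Re (u t) ^+ 2 + complex.Im (u t) ^+ 2)^-1).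
    by rewrite ReV; apply: cvgM.
  by apply/funext => s; rewrite ReV.
rewrite (_ : (fun y => _) = fun t => - (complex.Im (u t)
  * (complex.Re (u t) ^+ 2 + complex.Im (u t) ^+ 2)^-1)).
  by rewrite ImV; apply: cvgN; apply: cvgM.
by apply/funext => s; rewrite ImV.
Qed.

Definition cintegrable (R : realType) (a b : R) (u : R -> R[i]) : Prop :=
  real_integrable `[a, b] (fun t => complex.Re (u t)) /\
  real_integrable `[a, b] (fun t => complex.Im (u t)).

Definition cintegral (R : realType) (a b : R) (u : R -> R[i]) : R[i] :=
  Rintegral lebesgue_measure `[a, b] (fun t => complex.Re (u t)) +i*
  Rintegral lebesgue_measure `[a, b] (fun t => complex.Im (u t)).

Lemma ccontinuous_cintegrable (R : realType) (a b : R) (u : R -> R[i]) :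
  ccontinuous a b u -> cintegrable a b u.
Proof.
by move=> cu; split; apply: continuous_real_integrable => x xab;
  have [] := cu x xab.
Qed.

Lemma cintegral_cderive (R : realType) (a b : R) (u : R -> R[i]) :
  a < b -> cC1 u -> cintegral a b (cderive u) = u b - u a.
Proof.
move=> ab [ur ui]; rewrite /cintegral /cderive /= !Rintegral_derive1 //.
by case: (u a) (u b) => [? ?] [? ?].
Qed.

Lemma cintegral_eq_off_seq (R : realType) (a b : R) (s : seq R) (u v : R -> R[i]) :
  cintegrable a b v ->
  (forall t, a <= t <= b -> t \notin s -> u t = v t) ->
  cintegrable a b u /\ cintegral a b u = cintegral a b v.
Proof.
move=> [vr vi] uv.
have [ur eur] := @Rintegral_eq_off_seq R `[a, b] s
  (fun t => complex.Re (u t)) (fun t => complex.Re (v t)) (measurable_itv _) vr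
  (fun t tab ts => congr1 (@complex.Re _) (uv t tab ts)).
have [ui eui] := @Rintegral_eq_off_seq R `[a, b] s
  (fun t => complex.Im (u t)) (fun t => complex.Im (v t)) (measurable_itv _) vi
  (fun t tab ts => congr1 (@complex.Im _) (uv t tab ts)).
by split=> //; rewrite /cintegral eur eui.
Qed.

Lemma cintegral_concat (R : realType) (a b c : R) (u : R -> R[i]) :
  a < b -> b < c -> cintegrable a b u -> cintegrable b c u ->
  cintegrable a c u /\ cintegral a c u = cintegral a b u + cintegral b c u.
Proof.
move=> ab bc [r1 i1] [r2 i2].
have [r3 er] := Rintegral_concat ab bc r1 r2.
have [i3 ei] := Rintegral_concat ab bc i1 i2.
by split=> //; rewrite /cintegral er ei.
Qed.

Lemma cintegralD (R : realType) (a b : R) (u v : R -> R[i]) :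
  cintegrable a b u -> cintegrable a b v ->
  cintegrable a b (fun t => u t + v t) /\
  cintegral a b (fun t => u t + v t) = cintegral a b u + cintegral a b v.
Proof.
move=> [ur ui] [vr vi].
have eR : (fun t => complex.Re (u t + v t)) =
    fun t => complex.Re (u t) + complex.Re (v t) by apply/funext => t; rewrite ReD.
have eI : (fun t => complex.Im (u t + v t)) =
    fun t => complex.Im (u t) + complex.Im (v t) by apply/funext => t; rewrite ImD.
rewrite /cintegrable /cintegral eR eI; split; last by rewrite !RintegralD.
by split; apply: real_integrableD.
Qed.

Lemma cintegralZ (R : realType) (a b : R) (c : R[i]) (u : R -> R[i]) :
  cintegrable a b u ->
  cintegrable a b (fun t => c * u t) /\
  cintegral a b (fun t => c * u t) = c * cintegral a b u.
Proof.
move=> [ur ui].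
have z (k : R) f : real_integrable `[a, b] f ->
    real_integrable `[a, b] (fun t => k * f t).
  by move=> hf; apply: real_integrableZ.
have eR : (fun t => complex.Re (c * u t)) =
    fun t => complex.Re c * complex.Re (u t) + (- complex.Im c) * complex.Im (u t).
  by apply/funext => t; rewrite ReM mulNr.
have eI : (fun t => complex.Im (c * u t)) =
    fun t => complex.Re c * complex.Im (u t) + complex.Im c * complex.Re (u t).
  by apply/funext => t; rewrite ImM.
rewrite /cintegrable /cintegral eR eI; split.
  by split; apply: real_integrableD => //; apply: z.
rewrite !RintegralD //; try exact: z.
rewrite !RintegralZl //; case: c {eR eI} => [x y] /=.
by apply: complex_ext; rewrite /= ?mulNr.
Qed.

(** Restricted to the open interval, because at [a] and [b] the two-sided derivative of [g] also
    sees what lies beyond the piece. *)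
Lemma cderive_eq_itv (R : realType) (a b t : R) (g h : R -> R[i]) :
  (forall s, a <= s <= b -> g s = h s) -> a < t < b ->
  cderive g t = cderive h t.
Proof.
move=> gh tab; rewrite /cderive !derive1E.
have tin : t \in `]a, b[ by rewrite in_itv.
congr (_ +i* _); apply: near_eq_derive; near=> s; rewrite gh //;
  have : s \in `]a, b[ by near: s; exact: near_in_itvoo.
- by rewrite in_itv /= => /andP[/ltW -> /ltW ->].
- by rewrite in_itv /= => /andP[/ltW -> /ltW ->].
Unshelve. all: by end_near.
Qed.

(** Induction principle that hides the list of break points: integrability and primitives are
    treated on one smooth piece and glued. *)
Lemma piecewise_C1_ind (R : realType) (g : R -> R[i]) (Q : R -> R -> Prop) :
  piecewise_C1 g ->
  (forall a b h, 0 <= a -> a < b -> b <= 1 -> cC1 h ->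
     (forall t, a <= t <= b -> g t = h t) -> Q a b) ->
  (forall a b c, a < b -> b < c -> Q a b -> Q b c -> Q a c) ->
  Q 0 1.
Proof.
case=> s [ps ls hs] Qpiece Qcat.
have H a s' : path <%R a s' -> last a s' = 1 -> 0 <= a -> s' != [::] ->
    (forall j, (j < size s')%N -> exists h : R -> R[i], cC1 h /\
       forall t, nth 0 (a :: s') j <= t <= nth 0 s' j -> g t = h t) ->
    Q a 1.
  elim: s' a => [//|b s' IH] a /= /andP[ab pb] lb a0 _ hp.
  have [h [Ch gh]] := hp 0%N isT.
  have b_last : s' != [::] -> b < 1.
    rewrite -lb; case: s' {IH hp lb gh} pb => [//|c s'] pb _.
    have /allP/(_ (last c s')) := order_path_min lt_trans pb.
    by rewrite mem_last => /(_ isT).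
  have b1 : b <= 1.
    have [s0|/b_last /ltW //] := eqVneq s' [::].
    by rewrite -lb s0.
  have Qab : Q a b by apply: Qpiece Ch gh.
  have [s0|s0] := eqVneq s' [::]; first by move: lb; rewrite s0 /= => <-.
  have Qb1 : Q b 1.
    by apply: IH => //; [exact: le_trans (ltW ab)|move=> j js; exact: hp j.+1 js].
  exact: Qcat ab (b_last s0) Qab Qb1.
apply: (H 0 s) => //.
  by apply/eqP => s0; move: ls; rewrite s0 /= => /eqP; rewrite eq_sym oner_eq0.
by move=> j js; have [h [h1 h2 h3]] := hs j js; exists h.
Qed.

(** * Rational functions integrated along closed curves *)

Definition contour_integrable (R : realType) (g : R -> R[i]) (f : R[i] -> R[i]) :=
  cintegrable 0 1 (fun t => f (g t) * cderive g t).

Lemma contour_integralE (R : realType) (g : R -> R[i]) (f : R[i] -> R[i]) :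
  contour_integral g f = cintegral 0 1 (fun t => f (g t) * cderive g t).
Proof. by []. Qed.

Lemma contour_piece (R : realType) (a b : R) (g h : R -> R[i]) (f : R[i] -> R[i]) :
  (forall s, a <= s <= b -> g s = h s) ->
  cintegrable a b (fun t => f (h t) * cderive h t) ->
  cintegrable a b (fun t => f (g t) * cderive g t) /\
  cintegral a b (fun t => f (g t) * cderive g t) =
  cintegral a b (fun t => f (h t) * cderive h t).
Proof.
move=> gh ih; apply: (@cintegral_eq_off_seq _ _ _ [:: a; b]) => // t tab.
rewrite !inE negb_or => /andP[ta tb]; rewrite gh //; congr (_ * _).
apply: cderive_eq_itv gh _; case/andP: tab => [h1 h2].
by rewrite !lt_neqAle h1 h2 eq_sym ta tb.
Qed.

Lemma contour_integrable_inv (R : realType) (g : R -> R[i]) (a : R[i]) :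
  piecewise_C1 g -> off_curve g a -> contour_integrable g (fun w => (w - a)^-1).
Proof.
move=> pg oa; apply: (piecewise_C1_ind (Q := fun x y =>
  cintegrable x y (fun t => (g t - a)^-1 * cderive g t)) pg).
- move=> x y h x0 xy y1 Ch gh.
  apply: (@contour_piece _ _ _ _ _ (fun w => (w - a)^-1) gh _).1.
  have [_ cd] := cC1_ccontinuous x y Ch.
  apply: ccontinuous_cintegrable; apply: ccontinuous_mul cd.
  apply: ccontinuous_inv; last first.
    exact: (cC1_ccontinuous x y (cC1_sub_cst a Ch)).1.
  move=> t /andP[xt ty]; rewrite subr_eq0 -gh ?xt //; apply: oa.
  by rewrite (le_trans x0 xt) (le_trans ty y1).
- by move=> x y z xy yz q1 q2; have [] := cintegral_concat xy yz q1 q2.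
Qed.

(** The primitive [w ^+ k.+1 / k.+1] has increments that telescope over the pieces, and the curve is
    closed. *)
Lemma contour_integral_pow (R : realType) (g : R -> R[i]) (k : nat) :
  piecewise_C1 g -> g 0 = g 1 ->
  contour_integrable g (fun w => w ^+ k) /\
  contour_integral g (fun w => w ^+ k) = 0.
Proof.
move=> pg g01; rewrite contour_integralE.
pose F (z : R[i]) := k.+1%:R^-1 * z ^+ k.+1.
suff [i1 ->] : cintegrable 0 1 (fun t => g t ^+ k * cderive g t) /\
    cintegral 0 1 (fun t => g t ^+ k * cderive g t) = F (g 1) - F (g 0).
  by rewrite g01 subrr.
apply: (piecewise_C1_ind (Q := fun x y =>
  cintegrable x y (fun t => g t ^+ k * cderive g t) /\
  cintegral x y (fun t => g t ^+ k * cderive g t) = F (g y) - F (g x)) pg).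
- move=> x y h x0 xy y1 Ch gh.
  have ih : cintegrable x y (fun t => h t ^+ k * cderive h t).
    apply: ccontinuous_cintegrable; apply: ccontinuous_mul.
      exact: (cC1_ccontinuous x y (cC1_pow k Ch)).1.
    exact: (cC1_ccontinuous x y Ch).2.
  have [ig ->] := @contour_piece _ _ _ _ _ (fun w => w ^+ k) gh ih.
  split=> //; rewrite !gh ?lexx ?(ltW xy) // /F -mulrBr.
  rewrite -(cintegral_cderive xy (cC1_pow k.+1 Ch)).
  have -> : cderive (fun t => h t ^+ k.+1) =
      fun t => k.+1%:R * (h t ^+ k * cderive h t).
    by apply/funext => t; rewrite cderive_pow.
  have [_ ->] := cintegralZ k.+1%:R ih.
  by rewrite mulKf // pnatr_eq0.
- move=> x y z xy yz [q1 e1] [q2 e2].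
  have [q3 ->] := cintegral_concat xy yz q1 q2.
  by split=> //; rewrite e1 e2; ring.
Qed.

(** Integrability travels with the value, since additivity of the integral requires it. *)
Definition has_contour_integral (R : realType) (g : R -> R[i])
    (f : R[i] -> R[i]) (v : R[i]) : Prop :=
  contour_integrable g f /\ contour_integral g f = v.

Lemma has_contour_integralD (R : realType) (g : R -> R[i]) (f1 f2 : R[i] -> R[i])
    (v1 v2 : R[i]) :
  has_contour_integral g f1 v1 -> has_contour_integral g f2 v2 ->
  has_contour_integral g (fun z => f1 z + f2 z) (v1 + v2).
Proof.
move=> [i1 <-] [i2 <-]; have [i3 e3] := cintegralD i1 i2.
have E : (fun t => (f1 (g t) + f2 (g t)) * cderive g t) =
    fun t => f1 (g t) * cderive g t + f2 (g t) * cderive g t.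
  by apply/funext => t; rewrite mulrDl.
by rewrite /has_contour_integral /contour_integrable contour_integralE E.
Qed.

Lemma has_contour_integralZ (R : realType) (g : R -> R[i]) (f : R[i] -> R[i])
    (c v : R[i]) :
  has_contour_integral g f v ->
  has_contour_integral g (fun z => c * f z) (c * v).
Proof.
move=> [i1 <-]; have [i3 e3] := cintegralZ c i1.
have E : (fun t => c * f (g t) * cderive g t) =
    fun t => c * (f (g t) * cderive g t).
  by apply/funext => t; rewrite mulrA.
by rewrite /has_contour_integral /contour_integrable contour_integralE E.
Qed.

Lemma has_contour_integral_off_seq (R : realType) (g : R -> R[i]) (s : seq R)
    (f1 f2 : R[i] -> R[i]) (v : R[i]) :
  (forall t, 0 <= t <= 1 -> t \notin s -> f1 (g t) = f2 (g t)) ->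
  has_contour_integral g f2 v -> has_contour_integral g f1 v.
Proof.
move=> e [i2 <-].
have [] := @cintegral_eq_off_seq _ _ _ s (fun t => f1 (g t) * cderive g t) _ i2.
  by move=> t t01 ts; rewrite e.
by split.
Qed.

Lemma has_contour_integral_sum (R : realType) (I : Type) (r : seq I)
    (g : R -> R[i]) (f : I -> R[i] -> R[i]) (v : I -> R[i]) :
  piecewise_C1 g -> g 0 = g 1 ->
  (forall i, has_contour_integral g (f i) (v i)) ->
  has_contour_integral g (fun z => \sum_(i <- r) f i z) (\sum_(i <- r) v i).
Proof.
move=> pg g01 hf; elim: r => [|i r IH].
  have := has_contour_integralZ 0 (contour_integral_pow 0 pg g01).
  rewrite mul0r big_nil; apply: (has_contour_integral_off_seq (s := [::])) => t _ _.
  by rewrite big_nil mul0r.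
rewrite big_cons; have := has_contour_integralD (hf i) IH.
by apply: (has_contour_integral_off_seq (s := [::])) => t _ _; rewrite big_cons.
Qed.

Lemma has_contour_integral_poly (R : realType) (g : R -> R[i]) (P : {poly R[i]}) :
  piecewise_C1 g -> g 0 = g 1 -> has_contour_integral g (fun z => P.[z]) 0.
Proof.
move=> pg g01.
have := @has_contour_integral_sum R _ (index_enum 'I_(size P)) g
  (fun i z => P`_i * z ^+ i) (fun i => P`_i * 0) pg g01
  (fun i => has_contour_integralZ P`_i (contour_integral_pow i pg g01)).
rewrite big1 => [|i _]; last by rewrite mulr0.
by apply: (has_contour_integral_off_seq (s := [::])) => t _ _; rewrite horner_coef.
Qed.

Lemma two_pi_i_neq0 (R : realType) : two_pi_i R != 0.
Proof.
by rewrite /two_pi_i eq_complex /= eqxx /= mulf_neq0 ?pnatr_eq0 // gt_eqF ?pi_gt0.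
Qed.

(** Residue theorem for simple poles without Cauchy's theorem: in the partial fraction expansion the
    polynomial part has a primitive, and each term [c / (z - u)] gives a winding number by
    definition. *)
Lemma has_contour_integral_rational (R : realType) (g : R -> R[i])
    (a : seq R[i]) (P : {poly R[i]}) :
  piecewise_C1 g -> g 0 = g 1 -> uniq a -> {in a, forall u, off_curve g u} ->
  has_contour_integral g (fun z => P.[z] / \prod_(v <- a) (z - v))
    (two_pi_i R * \sum_(u <- a)
       winding g u * (P.[u] / \prod_(v <- a | v != u) (u - v))).
Proof.
move=> pg g01 ua oa.
set D := \prod_(v <- a) ('X - v%:P).
have mD : D \is monic by exact: monic_prod_XsubC.
have sD : size D = (size a).+1 by exact: size_prod_XsubC.
have D0 : D != 0 by exact: monic_neq0.
have PE : P = P %/ D * D + P %% D by exact: divp_eq.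
have sM : (size (P %% D)%R <= size a)%N by rewrite -ltnS -sD ltn_modp.
have Mu u : u \in a -> (P %% D).[u] = P.[u].
  move=> ina; rewrite [in RHS]PE hornerD hornerM.
  by have /rootP -> : root D u; rewrite ?root_prod_XsubC // mulr0 add0r.
have DE z : D.[z] = \prod_(v <- a) (z - v).
  by rewrite horner_prod; apply: eq_bigr => v _; rewrite hornerXsubC.
pose c u := P.[u] / \prod_(v <- a | v != u) (u - v).
(* [has_contour_integral_sum] asks for an integral at every index, but only the [u] in [a] are known
   to be off the curve; hence the default 0. *)
pose f u z := if u \in a then c u * (z - u)^-1 else 0.
have hf u : has_contour_integral g (f u)
    (if u \in a then two_pi_i R * (winding g u * c u) else 0).
  rewrite /f; case: ifP => ina.
    have -> : two_pi_i R * (winding g u * c u) =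
        c u * contour_integral g (fun w => (w - u)^-1).
      by rewrite /winding -mulrA mulVKf ?two_pi_i_neq0 // mulrC.
    apply: has_contour_integralZ; split=> //.
    exact: contour_integrable_inv pg (oa u ina).
  have := has_contour_integral_poly 0 pg g01.
  by apply: (has_contour_integral_off_seq (s := [::])) => t _ _; rewrite horner0.
have := has_contour_integralD (has_contour_integral_poly (P %/ D) pg g01)
  (has_contour_integral_sum a pg g01 hf).
rewrite add0r mulr_sumr.
have -> : \sum_(u <- a) (if u \in a then two_pi_i R * (winding g u * c u) else 0)
    = \sum_(u <- a) two_pi_i R * (winding g u * c u).
  by rewrite big_seq [RHS]big_seq; apply: eq_bigr => u ->.
apply: (has_contour_integral_off_seq (s := [::])) => t t01 _.
have zD : D.[g t] != 0.
  rewrite DE prodf_seq_neq0; apply/allP => u ina; rewrite subr_eq0; exact: oa.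
rewrite -DE {1}PE hornerD hornerM mulrDl mulfK //; congr (_ + _).
rewrite (lagrange_interpolation ua sM) horner_sum mulr_suml.
rewrite big_seq [RHS]big_seq; apply: eq_bigr => u ina.
rewrite /f ina hornerZ Mu // -mulrA; congr (_ * _).
have uz : g t - u != 0 by rewrite subr_eq0; exact: oa.
apply: (mulIf zD); rewrite divfK // DE (bigD1_seq u) //= mulKf // horner_prod.
by apply: eq_bigr => v _; rewrite hornerXsubC.
Qed.

(** A simple curve visits each point at most once during [[0, 1)]; the time 1 is added because the
    end repeats the start. *)
Lemma curve_preimage_finite (R : realType) (g : R -> R[i]) (s : seq R[i]) :
  ccw_contour g ->
  exists r : seq R, forall t, 0 <= t <= 1 -> g t \in s -> t \in r.
Proof.
move=> [_ _ gI _]; elim: s => [|a s [r hr]]; first by exists [::].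
have [[t0 [t01 ga]]|no] := pselect (exists t, 0 <= t < 1 /\ g t = a).
  exists [:: 1, t0 & r] => t t1; rewrite !inE => /orP[/eqP gt|/(hr t t1) ->];
    last by rewrite !orbT.
  have [->//|tn1] := eqVneq t 1.
  have -> : t = t0; last by rewrite eqxx orbT.
  apply: gI => //; last by rewrite gt ga.
  by case/andP: t1 => -> /=; rewrite lt_neqAle tn1.
exists (1 :: r) => t t1; rewrite !inE => /orP[/eqP gt|/(hr t t1) ->];
  last by rewrite orbT.
have [->//|tn1] := eqVneq t 1.
exfalso; apply: no; exists t; split=> //.
by case/andP: t1 => -> /=; rewrite lt_neqAle tn1.
Qed.

(** All poles in [w], namely [z] and the integers [k], are enclosed, so every winding number is 1
    and the full residue sum collapses by [residues_quotient]. Keeping [z] apart from the [k] keeps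
    the poles simple. *)
Lemma red_inner_integral (R : realType) (n : nat) (beta : n.-tuple int)
    (p1 p2 : int * nat) (g : R -> R[i]) (z : R[i]) :
  ccw_contour g ->
  (forall k : int, k \in zrange (p1.1 + p1.2%:Z - n%:Z) p1.1 ->
     encloses g k%:~R) ->
  encloses g z ->
  z \notin [seq k%:~R | k <- zrange (p1.1 + p1.2%:Z - n%:Z) p1.1] ->
  contour_integral g (fun w => red_integrand beta p1 p2 z w) =
  two_pi_i R *
  ((\prod_(k <- zrange (p2.1 + p2.2%:Z - n%:Z) (p2.1 - 1)) (z - k%:~R))
   * (kernel_quotient R[i] beta p1).[z] / \prod_(b <- beta) (z - b%:~R)).
Proof.
move=> [pg g01 _ _] enc encz znk.
set ks : seq R[i] := [seq k%:~R | k <- zrange _ _] in znk.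
have uks : uniq ks by rewrite map_inj_uniq ?zrange_uniq //; exact: intr_inj.
have uz : uniq (z :: ks) by rewrite /= znk uks.
have encks : {in z :: ks, forall u, encloses g u}.
  by move=> u; rewrite inE => /orP[/eqP -> //|/mapP[k hk ->]]; exact: enc.
set B := \prod_(b <- beta) ('X - (b%:~R)%:P : {poly R[i]}).
set N := \prod_(k <- _) _.
have := has_contour_integralZ (N / \prod_(b <- beta) (z - b%:~R))
  (has_contour_integral_rational B pg g01 uz (fun u hu => (encks u hu).1)).
rewrite [X in two_pi_i R * X](_ : _ = (kernel_quotient R[i] beta p1).[z]); last first.
  rewrite /kernel_quotient size_tuple -/B.
  have -> : \prod_(k <- zrange (p1.1 + p1.2%:Z - n%:Z) p1.1) ('X - (k%:~R)%:P) =
      \prod_(v <- ks) ('X - v%:P).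
    by rewrite [RHS]big_map.
  rewrite -(residues_quotient B uz) big_seq [RHS]big_seq.
  by apply: eq_bigr => u hu; rewrite (encks u hu).2 mul1r.
have -> (c d e : R[i]) : N / c * (d * e) = d * (N * e / c) by ring.
case=> _ <-; congr contour_integral; apply/funext => w.
have BE : B.[w] = \prod_(i < n) (w - (tnth beta i)%:~R).
  rewrite horner_prod big_tuple; apply: eq_bigr => i _.
  by rewrite hornerXsubC.
rewrite /red_integrand -/N big_cons [\prod_(v <- ks) _]big_map BE big_tuple.
by rewrite big_split /= prodfV invfM; ring.
Qed.

(** [P] records which entries of [beta] the z-contour encloses, so that one computation serves both
    double integrals of the kernel. *)
Lemma red_double_integralE (R : realType) (n : nat) (beta : n.-tuple int)
    (p1 p2 : int * nat) (gz gw : R -> R[i]) (P : pred int) :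
  uniq beta -> ccw_contour gz ->
  (forall b : int, b \in beta -> P b -> encloses gz b%:~R) ->
  (forall b : int, b \in beta -> ~~ P b -> avoids gz b%:~R) ->
  W_contour n p1 gz gw ->
  red_double_integral beta p1 p2 gz gw =
  \sum_(b <- beta | P b) kernel_residue R[i] beta p1 p2 b.
Proof.
move=> ub cz enc av [cw wk wz].
have [pg g01 _ _] := cz.
set ks : seq R[i] := [seq k%:~R | k <- zrange (p1.1 + p1.2%:Z - n%:Z) p1.1].
(* [r] contains the times at which the z-contour meets a pole [k] of the w-integrand, where
   [red_inner_integral] does not apply. *)
have [r hr] := curve_preimage_finite ks cz.
pose bF : seq R[i] := [seq b%:~R | b <- beta].
have ubF : uniq bF by rewrite map_inj_uniq //; exact: intr_inj.
have obF : {in bF, forall u, off_curve gz u}.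
  move=> u /mapP[b hb ->]; have [Pb|nPb] := boolP (P b).
    exact: (enc b hb Pb).1.
  exact: (av b hb nPb).1.
pose NP : {poly R[i]} :=
  (\prod_(k <- zrange (p2.1 + p2.2%:Z - n%:Z) (p2.1 - 1)) ('X - (k%:~R)%:P))
  * kernel_quotient R[i] beta p1.
have NPE z : NP.[z] =
  (\prod_(k <- zrange (p2.1 + p2.2%:Z - n%:Z) (p2.1 - 1)) (z - k%:~R))
  * (kernel_quotient R[i] beta p1).[z].
  rewrite hornerM horner_prod; congr (_ * _).
  by apply: eq_bigr => k _; rewrite hornerXsubC.
have [] := has_contour_integral_off_seq (s := r)
  (f1 := fun z => contour_integral gw (fun w => red_integrand beta p1 p2 z w)) _
  (has_contour_integralZ (two_pi_i R)
    (has_contour_integral_rational NP pg g01 ubF obF)).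
  move=> t t01 tr; rewrite (red_inner_integral beta p2 cw wk (wz t t01)).
    by rewrite NPE [\prod_(v <- bF) _]big_map.
  by apply: contra tr => /(hr t t01).
rewrite /red_double_integral => _ ->.
rewrite mulrA -expr2 mulKf ?sqrf_eq0 ?two_pi_i_neq0 //.
rewrite [LHS]big_map [RHS]big_mkcond big_seq [RHS]big_seq.
apply: eq_bigr => b hb; rewrite /kernel_residue size_tuple NPE.
have -> : \prod_(v <- bF | v != b%:~R) (b%:~R - v) =
    \prod_(v <- beta | v != b) (b%:~R - v%:~R).
  by rewrite [LHS]big_map; apply: eq_bigl => v; rewrite (inj_eq intr_inj).
by case: ifPn => Pb; [rewrite (enc b hb Pb).2 mul1r|rewrite (av b hb Pb).2 mul0r].
Qed.

Theorem proposition1p1 (R : realType) (n : nat) (beta : n.-tuple int)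
    (hn : (0 < n)%N) (hbeta : sorted (fun a b : int => b < a) beta)
    (Z W Z' W' : int * nat -> int * nat -> R -> R[i])
    (hZ : forall p1 p2, positions beta p1 -> positions beta p2 ->
       Z_contour beta p2.1 (Z p1 p2))
    (hW : forall p1 p2, positions beta p1 -> positions beta p2 ->
       W_contour n p1 (Z p1 p2) (W p1 p2))
    (hZ' : forall p1 p2, positions beta p1 -> positions beta p2 ->
       Z'_contour beta p2.1 (Z' p1 p2))
    (hW' : forall p1 p2, positions beta p1 -> positions beta p2 ->
       W_contour n p1 (Z' p1 p2) (W' p1 p2)) :
  determinantal (uniform_prob R (interlacing beta)) red (positions beta)
    (K_red beta Z W Z' W').
Proof.
move=> k p pI pD.
pose L := nth 0 beta n.-1.
have sb := size_tuple beta.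
have db : decreasing (size beta) beta.
  split=> // j jm; have /(sortedP 0)/(_ j) := hbeta; exact.
have ub : uniq beta.
  apply: sorted_uniq hbeta; first by move=> a b c /= ba cb; exact: lt_trans cb ba.
  by move=> a /=; rewrite ltxx.
have Lb j : (j < size beta)%N -> L <= nth 0 beta j.
  rewrite sb => jn; have [->|jn1] := eqVneq j n.-1; first exact: lexx.
  apply/ltW/(decreasing_lt db); rewrite ?sb ?prednK //.
  by rewrite ltn_neqAle jn1 -ltnS prednK.
(* On [positions], [x >= L + n - y] with [y <= n - 1], so the points lie to the right of the column
   of sources. *)
have pL s : L <= (p s).1.
  have [/andP[_ yn]] := pD s; rewrite -/L.
  by move: (p s).1 (p s).2 yn => x y yn; clearbody L; lia.
have pn s : (0 < (p s).2 <= n)%N by have [/andP[-> yn] _] := pD s; apply: leq_trans yn (leq_pred _).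
have KE i j : K_red beta Z W Z' W' (p i) (p j) = residue_kernel R[i] beta (p i) (p j).
  rewrite /K_red /residue_kernel.
  have [cZ eZ aZ] := hZ _ _ (pD i) (pD j).
  have [cZ' eZ' aZ'] := hZ' _ _ (pD i) (pD j).
  rewrite (red_double_integralE (P := fun b => (p j).1 <= b) (p j) ub cZ eZ _
    (hW _ _ (pD i) (pD j))); last first.
    by move=> b hb; rewrite -ltNge => bx; apply: aZ => //; lia.
  rewrite (red_double_integralE (P := fun b => b < (p j).1) (p j) ub cZ' eZ' _
    (hW' _ _ (pD i) (pD j))) //.
  by move=> b hb; rewrite -leNgt => bx; apply: aZ'.
rewrite (@uniform_prob_red _ _ _ L _ _ hn pL pn).
under eq_mx do rewrite KE.
have pn' s : (0 < (p s).2 <= size beta)%N by rewrite sb.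
rewrite -(size_arrays_kernel R[i] db Lb pI pL pn') sb.
by rewrite fmorph_div /= !rmorph_nat.
Qed.
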